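(* Let $G$ be a connected graph with $m$ edges and $n$ vertices. Then a lattice cycle basis of $G$ exists, and can be constructed in time $O(mn)$. If $T$ is any spanning tree of $G$, then the basis may be chosen to be semi-fundamental with respect to $T$.
   Context: Graphs may have loops and parallel edges. A cycle of $G=(V,E)$ is a connected subgraph in which every vertex has degree two, regarded as a subset of $E$; $\mathcal{C}(G)$ is the set of cycles and $\chi_A\in\mathbb{Z}^E$ is the characteristic vector of $A\subseteq E$. The cycle lattice is $\mathcal{L}(\mathcal{C}(G)) = \{\sum_{C\in\mathcal{C}(G)} n_C\chi_C : n_C\in\mathbb{Z}\}$. A lattice cycle basis of $G$ is a collection of cycles of $G$ whose characteristic vectors form a basis (over $\mathbb{Z}$) of $\mathcal{L}(\mathcal{C}(G))$. For a spanning tree $T$ and $e\in E\setminus T$, $\mathrm{ci}(e,T)$ is the unique cycle contained in $T\cup\{e\}$ (the fundamental cycle). For distinct $e,f\in E\setminus T$ such that $\mathrm{ci}(e,T)$ and $\mathrm{ci}(f,T)$ share at least one edge of $T$, the symmetric difference $\mathrm{ci}(ef,T):=\mathrm{ci}(e,T)\,\triangle\,\mathrm{ci}(f,T)$ is called a semi-fundamental cycle with respect to $T$. A lattice cycle basis is semi-fundamental with respect to $T$ if it contains all fundamental cycles $\mathrm{ci}(e,T)$, $e\in E\setminus T$, and all its other cycles are semi-fundamental with respect to $T$. Computational model: the vertex set is totally ordered and the graph is given as an ordered adjacency list, so inspecting the edges at a vertex $v$ takes time $O(\deg v)$ and inspecting all edges takes time $O(m)$. *)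

(* Defs.v *)
From mathcomp Require Import all_boot all_order all_algebra.

Set Implicit Arguments.
Unset Strict Implicit.
Unset Printing Implicit Defensive.

Import GRing.Theory.

(* Undirected multigraphs with loops and parallel edges.  The two ends of an
   edge are stored as a pair, whose order no definition below depends on; a
   loop is an edge whose two ends coincide. *)
Record mgraph (V E : finType) := MGraph { ends : E -> V * V }.

Section Graphs.
Variables (V E : finType) (G : mgraph V E).
Implicit Types (A C T : {set E}) (B : {set {set E}}) (e f : E) (v : V).

(* A loop counts twice at its vertex. *)
Definition incidence e v : nat := ((ends G e).1 == v) + ((ends G e).2 == v).

Definition degree_in A v : nat := \sum_(e in A) incidence e v.

Definition adjacent_in A : rel V :=
  [rel u v | [exists e in A, (ends G e == (u, v)) || (ends G e == (v, u))]].

Definition vertices_of A : {set V} :=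
  [set v | [exists e in A, 0 < incidence e v]].

(* As usual, the null graph is not connected. *)
Definition connected_graph : Prop :=
  0 < #|V| /\ forall u v, connect (adjacent_in [set: E]) u v.

Definition is_cycle C : bool :=
  [&& C != set0,
      [forall v in vertices_of C, degree_in C v == 2]
    & [forall u in vertices_of C, forall v in vertices_of C,
         connect (adjacent_in C) u v]].

Definition cycles : {set {set E}} := [set C | is_cycle C].

Definition spanning_tree T : Prop :=
  (forall u v, connect (adjacent_in T) u v) /\
  (forall C, is_cycle C -> ~~ (C \subset T)).

Definition chi A : {ffun E -> int} := [ffun e => (e \in A)%:R%R].

Definition lattice B (x : {ffun E -> int}) : Prop :=
  exists c : {set E} -> int, x = (\sum_(C in B) chi C *~ c C)%R.

Definition cycle_lattice : {ffun E -> int} -> Prop := lattice cycles.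

Definition lattice_cycle_basis B : Prop :=
  [/\ B \subset cycles,
      forall x, cycle_lattice x <-> lattice B x
    & forall c : {set E} -> int,
        (\sum_(C in B) chi C *~ c C)%R = 0%R -> {in B, forall C, c C = 0%R}].

(* [ci T e] is meant for a spanning tree T and an edge e outside T, in which
   case exactly one set qualifies and the default set0 is never taken. *)
Definition ci T e : {set E} :=
  odflt set0 [pick C | is_cycle C & C \subset e |: T].

Definition ci2 T e f : {set E} :=
  (ci T e :\: ci T f) :|: (ci T f :\: ci T e).

Definition fundamental T C : Prop := exists2 e, e \notin T & C = ci T e.

Definition semi_fundamental T C : Prop :=
  exists e f, [/\ e != f, e \notin T, f \notin T,
                  ci T e :&: ci T f :&: T != set0 & C = ci2 T e f].

Definition semi_fundamental_basis T B : Prop :=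
  [/\ lattice_cycle_basis B,
      forall e, e \notin T -> ci T e \in B
    & {in B, forall C, fundamental T C \/ semi_fundamental T C}].

End Graphs.

(* A random access machine with finitely many registers and arrays of natural
   numbers (those mentioned in the program).  It has no addition other than
   successor: a step then exceeds the largest number stored so far by at most a
   constant, so numbers occurring within t steps from an input of size s have
   O(log (s + t)) bits, and unit cost per step is the usual logarithmic
   word-size cost up to a constant. *)
Inductive expr : Type :=
| Const of nat
| Reg of nat
| Cell of nat & expr        (* array, index *)
| Succ of expr
| Sub of expr & expr        (* truncated *)
| Equal of expr & expr      (* 1 if true, 0 if false *)
| Less of expr & expr.

Inductive program : Type :=
| Skip
| SetReg of nat & expr
| SetCell of nat & expr & expr   (* array, index, value *)
| Seq of program & program
| If of expr & program & program
| While of expr & program.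

Record state := State { reg : nat -> nat; arr : nat -> nat -> nat }.

Definition set_reg (s : state) (x v : nat) : state :=
  State (fun y => if y == x then v else reg s y) (arr s).

Definition set_cell (s : state) (a i v : nat) : state :=
  State (reg s)
    (fun b j => if (b == a) && (j == i) then v else arr s b j).

Fixpoint eval (s : state) (x : expr) : nat :=
  match x with
  | Const k => k
  | Reg r => reg s r
  | Cell a y => arr s a (eval s y)
  | Succ y => (eval s y).+1
  | Sub y z => eval s y - eval s z
  | Equal y z => eval s y == eval s z
  | Less y z => eval s y < eval s z
  end.

(* [exec p s t s']: started in s, p halts in s' after t steps.  A step is an
   assignment or the evaluation of a test; an expression has constant size as
   it is part of the program. *)
Inductive exec : program -> state -> nat -> state -> Prop :=
| ExecSkip s : exec Skip s 1 s
| ExecSetReg s r x : exec (SetReg r x) s 1 (set_reg s r (eval s x))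
| ExecSetCell s a i x :
    exec (SetCell a i x) s 1 (set_cell s a (eval s i) (eval s x))
| ExecSeq p q s t s' t' s'' :
    exec p s t s' -> exec q s' t' s'' -> exec (Seq p q) s (t + t') s''
| ExecIfTrue x p q s t s' :
    eval s x != 0 -> exec p s t s' -> exec (If x p q) s t.+1 s'
| ExecIfFalse x p q s t s' :
    eval s x = 0 -> exec q s t s' -> exec (If x p q) s t.+1 s'
| ExecWhileTrue x p s t s' t' s'' :
    eval s x != 0 -> exec p s t s' -> exec (While x p) s' t' s'' ->
    exec (While x p) s (t + t').+1 s''
| ExecWhileFalse x p s : eval s x = 0 -> exec (While x p) s 1 s.

(* A list of lists ll is laid out in two arrays: [offsets ll i] is the starting
   position, for i <= size ll, of the i-th list in the concatenation. *)
Definition offsets (T : Type) (ll : seq (seq T)) (i : nat) : nat :=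
  sumn (take i (map size ll)).

Section GraphInput.
Variables (n m : nat) (G : mgraph 'I_n 'I_m).
Implicit Types (L : 'I_n -> seq 'I_m) (T : {set 'I_m}).

Definition other_end (v : 'I_n) (e : 'I_m) : 'I_n :=
  if (ends G e).1 == v then (ends G e).2 else (ends G e).1.

(* L v lists the edges at v in the order of their other ends; the order among
   parallel edges is arbitrary, and a loop is listed twice, so that L v has
   length deg v. *)
Definition ordered_adjacency_list L : Prop :=
  forall v, (forall e, count_mem e (L v) = incidence G e v) /\
            sorted leq [seq val (other_end v e) | e <- L v].

Definition adjacency_rows L : seq (seq (nat * nat)) :=
  [seq [seq (val e, val (other_end v e)) | e <- L v] | v <- enum 'I_n].

(* Registers 0 and 1 hold n and m; arrays 0, 1 and 2 hold the offsets, the edge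
   names and the other ends of the adjacency list.  All the rest is zero. *)
Definition graph_input L : state :=
  State (nth 0 [:: n; m])
    (fun a i =>
       match a with
       | 0 => if i <= n then offsets (adjacency_rows L) i else 0
       | 1 => (nth (0, 0) (flatten (adjacency_rows L)) i).1
       | 2 => (nth (0, 0) (flatten (adjacency_rows L)) i).2
       | _ => 0
       end).

(* Array 3 additionally holds the characteristic vector of T. *)
Definition graph_tree_input L T : state :=
  State (reg (graph_input L))
    (fun a i => if a == 3 then nat_of_bool (i \in [seq val e | e in T])
                else arr (graph_input L) a i).

(* The final state lists the members of B without repetition, each as a
   repetition-free list of its edges: their number is in register 2, the
   offsets and the edge names in arrays 4 and 5. *)
Definition output_is (s : state) (B : {set {set 'I_m}}) : Prop :=
  exists ll : seq (seq 'I_m),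
    [/\ all uniq ll,
        uniq [seq [set e in c] | c <- ll],
        B = [set C in [seq [set e in c] | c <- ll]],
        reg s 2 = size ll
      & (forall i, i <= size ll -> arr s 4 i = offsets ll i) /\
        (forall i, i < size (flatten ll) ->
           arr s 5 i = nth 0 (map val (flatten ll)) i)].

Definition outputs_within (p : program) (s : state) (bound : nat)
    (B : {set {set 'I_m}}) : Prop :=
  exists t s', [/\ exec p s t s', t <= bound & output_is s' B].

End GraphInput.

(* Main.v *)
Require Import Defs.
From mathcomp Require Import all_boot all_order all_algebra.
From mathcomp Require Import zify.

(* Call an edge set even if all its degrees are even.  Nonempty even sets
   contain cycles, so modulo a spanning tree T an even set is determined by its
   edges outside T.  For a tree edge t let N t be the set of nontree edges whose
   fundamental cycle contains t.  If ci e and ci f share a tree edge, then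
   2 chi (ci e :&: ci f :&: T) = chi (ci e) + chi (ci f) - chi (ci2 e f).
   For every t with at least two edges in N t there are e, f in N t such that
   ci e and ci f share exactly the tree edges s with N t \subset N s.  One such
   pair for each value of N gives vectors that are triangular with respect to
   #|N t|; with the fundamental cycles they form a basis, because for a cycle C
   the vector chi C - \sum_(e in C :\: T) chi (ci e) lives on T, is even, depends
   at t only on N t, and vanishes at t if N t has at most one element.

   To find a pair for t, number the vertices in preorder.  Seen from t, the far
   side of any other tree edge is a cyclic interval on one of the two sides of
   t, so the paths of four edges of N t, having extreme ends on either side of
   t, meet in the common intersection of all paths through t.  Two of the four
   have the same intersection, since a path through t can be left only in two
   directions.  Each t takes time O(m + n). *)

Set Implicit Arguments.
Unset Strict Implicit.
Unset Printing Implicit Defensive.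

(** * Even edge sets and cycles *)

Section EvenSets.
Variables (V E : finType) (G : mgraph V E).
Implicit Types (A B C D S T : {set E}) (e f : E) (u v : V) (W : {set V}).

(** Over the two-element field the fundamental cycles would suffice. Over the integers a cycle
    keeps, at a tree edge t, only the parity of the number of fundamental cycles through t that it
    combines, and the even excess has to be supplied by further cycles. The obstacle is to obtain
    these from pairs: two fundamental cycles through t may share more tree edges than all of N t
    forces, and triangularity rests on a pair that attains the minimum. For the running time, trying
    all pairs or comparing the sets N t element by element would be too slow. Four candidates
    suffice for the pair, and once a tight pair is known, N s = N t is decided by whether both paths
    contain s and by cardinalities. A connected graph has n <= m + 1, so n * n steps are affordable,
    and so is rescanning all edges at each visit of the search. A prescribed tree needs no separate
    construction: the search is confined to the edges of T, and the spanning tree that it finds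
    inside T can only be T. *)

Definition even_set A := [forall v, ~~ odd (degree_in G A v)].

Definition symdiff A B := (A :\: B) :|: (B :\: A).

Lemma in_symdiff A B e : (e \in symdiff A B) = (e \in A) (+) (e \in B).
Proof. by rewrite !inE; case: (e \in A); case: (e \in B). Qed.

Lemma odd_degreeE A v :
  odd (degree_in G A v) =
  \big[addb/false]_e ((e \in A) && odd (incidence G e v)).
Proof.
rewrite /degree_in (big_morph odd oddD (erefl _)) big_mkcond /=.
by apply: eq_bigr => e _; case: (e \in A).
Qed.

Lemma odd_degree_symdiff A B v :
  odd (degree_in G (symdiff A B) v) =
  odd (degree_in G A v) (+) odd (degree_in G B v).
Proof.
rewrite !odd_degreeE -big_split; apply: eq_bigr => e _ /=.
by rewrite in_symdiff andb_addl.
Qed.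

Lemma odd_degree1 e v : odd (degree_in G [set e] v) = odd (incidence G e v).
Proof. by rewrite /degree_in big_set1. Qed.

Lemma odd_incidence e v :
  odd (incidence G e v) = ((ends G e).1 == v) (+) ((ends G e).2 == v).
Proof. by rewrite /incidence oddD !oddb. Qed.

Lemma even_symdiff A B : even_set A -> even_set B -> even_set (symdiff A B).
Proof.
move=> /forallP eA /forallP eB; apply/forallP => v.
by rewrite odd_degree_symdiff (negbTE (eA v)) (negbTE (eB v)).
Qed.

Lemma sum_addb_eq W x : \big[addb/false]_(v in W) (x == v) = (x \in W).
Proof.
rewrite big_mkcond (bigD1 x) //= eqxx big1 ?addbF; first by case: ifP.
by move=> v; rewrite eq_sym => /negbTE ->; case: ifP.
Qed.

(* Handshaking over W: an even set meets every cut evenly. *)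
Lemma sum_boundary A W :
  \big[addb/false]_(v in W) odd (degree_in G A v) =
  \big[addb/false]_(e in A) (((ends G e).1 \in W) (+) ((ends G e).2 \in W)).
Proof.
under eq_bigr => v _ do rewrite odd_degreeE.
rewrite exchange_big [RHS]big_mkcond; apply: eq_bigr => e _.
case: (e \in A) => /=; last by rewrite big1.
under eq_bigr => v _ do rewrite odd_incidence.
by rewrite big_split /= !sum_addb_eq.
Qed.

Lemma even_cut A W : even_set A ->
  \big[addb/false]_(e in A) (((ends G e).1 \in W) (+) ((ends G e).2 \in W))
  = false.
Proof.
by move=> /forallP eA; rewrite -sum_boundary big1 // => v _; apply/negbTE.
Qed.

Lemma incidence_gt0 e v :
  (0 < incidence G e v) = ((ends G e).1 == v) || ((ends G e).2 == v).
Proof. by rewrite /incidence; case: eqP; case: eqP. Qed.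

Lemma vertices_ofP A v :
  reflect (exists2 e, e \in A & 0 < incidence G e v) (v \in vertices_of G A).
Proof.
rewrite inE; apply: (iffP existsP) => [[e /andP[]]|[e eA ve]]; first by exists e.
by exists e; rewrite eA.
Qed.

Lemma degree_gt0 A v : (0 < degree_in G A v) = (v \in vertices_of G A).
Proof.
rewrite lt0n sum_nat_eq0 negb_forall inE.
by apply: eq_existsb => e; rewrite negb_imply lt0n.
Qed.

Lemma cycle_even C : is_cycle G C -> even_set C.
Proof.
case/and3P=> _ /forallP deg2 _; apply/forallP => v.
case: (boolP (v \in vertices_of G C)) (deg2 v) => /= [_ /eqP -> //|].
by rewrite -degree_gt0 lt0n negbK => /eqP ->.
Qed.

Lemma sum_degree A : \sum_v degree_in G A v = 2 * #|A|.
Proof.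
rewrite /degree_in exchange_big /= -sum1_card big_distrr /=.
apply: eq_bigr => e _; rewrite /incidence big_split /=.
have one x : \sum_(v : V) (x == v : nat) = 1.
  by rewrite (bigD1 x) //= eqxx big1 // => v; rewrite eq_sym => /negbTE ->.
by rewrite !one.
Qed.

Lemma degree_subset A B v : A \subset B -> degree_in G A v <= degree_in G B v.
Proof.
move=> sAB; rewrite /degree_in big_mkcond [leqRHS]big_mkcond leq_sum // => e _.
by case: ifP => // /(subsetP sAB) ->.
Qed.

Lemma symdiff_eq0 A B : symdiff A B = set0 -> A = B.
Proof.
move/setP => AB; apply/setP => e; have := AB e.
by rewrite in_symdiff inE; case: (e \in A); case: (e \in B).
Qed.

(** Degrees in [D] are even, hence at least two on [vertices_of G D], and a count shows that there
    are no more edges than vertices; the degree sum then forces degree two everywhere. Connectedness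
    follows from minimality, since the edges in the component of one vertex form an even set. *)
Lemma minimal_even_cycle D : D != set0 -> even_set D ->
  (forall A, even_set A -> A \subset D -> A != set0 -> A = D) -> is_cycle G D.
Proof.
move=> D0 evD minD.
have deg2 v : v \in vertices_of G D -> 2 <= degree_in G D v.
  rewrite -degree_gt0; have /negP := forallP evD v.
  by case: (degree_in G D v) => [|[|k]].
(* Boundary is injective on the subsets of D minus an edge, and misses the odd
   sets, whence |D| <= |V(D)|. *)
have leD : #|D| <= #|vertices_of G D|.
  have [e eD] := set0Pn _ D0.
  pose F := D :\ e; pose bd A := [set v | odd (degree_in G A v)].
  have bdD A : A \subset D -> bd A \subset vertices_of G D.
    move=> sAD; apply/subsetP => v; rewrite inE -degree_gt0 => /odd_gt0 H.
    exact: leq_trans H (degree_subset v sAD).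
  have bd_inj : {in powerset F &, injective bd}.
    move=> A B; rewrite !inE => sA sB AB; apply: symdiff_eq0; apply/eqP.
    apply: contraT => AB0.
    have : symdiff A B = D.
      apply: minD => //.
        apply/forallP => v; rewrite odd_degree_symdiff.
        by move/setP/(_ v): AB; rewrite !inE => ->; rewrite addbb.
      by rewrite subUset !(subset_trans (subsetDl _ _)) //
                 ?(subset_trans sA) ?(subset_trans sB) // subsetDl.
    move/setP/(_ e); rewrite in_symdiff eD.
    have eF : e \notin F by rewrite !inE eqxx.
    by rewrite (contraNF (subsetP sA e) eF) (contraNF (subsetP sB e) eF).
  have /card_in_imset cardF := bd_inj.
  have [v vD] : exists v, v \in vertices_of G D.
    by exists (ends G e).1; apply/vertices_ofP; exists e; rewrite ?incidence_gt0 ?eqxx.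
  have : bd @: powerset F \proper powerset (vertices_of G D).
    apply/properP; split.
      apply/subsetP => W /imsetP[A]; rewrite !inE => sA ->.
      by apply: bdD; apply: subset_trans sA (subsetDl _ _).
    exists [set v]; first by rewrite inE sub1set.
    apply/imsetP => -[A _ /setP bdA].
    have := sum_boundary A [set: V].
    rewrite [RHS]big1; last by move=> f _; rewrite !inE.
    under eq_bigr => w _.
      have := bdA w; rewrite !inE eq_sym => <-; over.
    by rewrite sum_addb_eq inE.
  move/proper_card; rewrite cardF !card_powerset ltn_exp2l //.
  by rewrite /F [#|D|](cardsD1 e) eD.
have deg_eq : forall v, v \in vertices_of G D -> degree_in G D v = 2.
  move=> v vD; apply/eqP; rewrite eqn_leq deg2 // andbT leqNgt; apply/negP => gt2.
  have := sum_degree D; rewrite (bigID (mem (vertices_of G D))) /=.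
  rewrite [X in _ + X]big1 ?addn0; last first.
    by move=> w; rewrite -degree_gt0 lt0n negbK => /eqP.
  apply/eqP; rewrite gtn_eqF //.
  apply: leq_ltn_trans (_ : 2 * #|vertices_of G D| < _); first by rewrite leq_mul2l.
  rewrite mulnC -sum_nat_const (bigD1 v) //= [ltnRHS](bigD1 v) //=.
  rewrite -addSn leq_add // leq_sum // => w /andP[wD _]; exact: deg2.
apply/and3P; split => //.
  by apply/forallP => v; apply/implyP => /deg_eq ->.
apply/forallP => u; apply/implyP => uD; apply/forallP => v; apply/implyP => vD.
pose K := [pred w | connect (adjacent_in G D) u w].
have Kstep e : e \in D -> K (ends G e).1 = K (ends G e).2.
  move=> eD; rewrite /=; apply/idP/idP => H; apply: connect_trans H (connect1 _).
    by apply/existsP; exists e; rewrite eD -surjective_pairing eqxx.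
  by apply/existsP; exists e; rewrite eD -surjective_pairing eqxx orbT.
pose A := [set e in D | K (ends G e).1].
have endK e w : e \in D -> 0 < incidence G e w -> K w = K (ends G e).1.
  by move=> eD; rewrite incidence_gt0 => /orP[] /eqP <- //; rewrite Kstep.
have degA w : degree_in G A w = if K w then degree_in G D w else 0.
  rewrite /degree_in; under eq_bigl => e do rewrite inE.
  rewrite big_mkcondr /=; case: ifP => Kw.
    apply: eq_bigr => e eD; case: ifP => // nK; apply/esym/eqP.
    rewrite -[_ == 0]negbK -lt0n; apply/negP => /(endK _ _ eD) /= H.
    by move: Kw; rewrite /= H nK.
  apply: big1 => e eD; case: ifP => // nK; apply/eqP.
  rewrite -[_ == 0]negbK -lt0n; apply/negP => /(endK _ _ eD) /= H.
  by move: Kw; rewrite /= H nK.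
have DA : A = D.
  apply: minD; last 1 first.
  - have [e eD ue] := vertices_ofP _ _ uD.
    apply/set0Pn; exists e; rewrite inE eD -(endK _ u) //=.
  - by apply/forallP => w; rewrite degA; case: ifP => // _; have := forallP evD w.
  - by apply/subsetP => e; rewrite inE => /andP[].
have [e eD ve] := vertices_ofP _ _ vD.
by have := endK _ _ eD ve; rewrite /= => ->; move: eD; rewrite -{1}DA inE => /andP[].
Qed.

Lemma even_cycle_sub D : D != set0 -> even_set D ->
  exists2 C, is_cycle G C & C \subset D.
Proof.
move=> D0 evD; pose P (A : {set E}) := (A != set0) && even_set A.
have [|C /minsetP[/andP[C0 evC] minC] CD] := @minset_exists _ P D.
  by rewrite /P D0.
exists C => //; apply: minimal_even_cycle => // A evA AC A0.
by apply: minC => //; rewrite /P A0.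
Qed.
End EvenSets.

(** * Spanning trees and fundamental cycles *)

Section SpanningTree.
Variables (V E : finType) (G : mgraph V E) (T : {set E}).
Hypothesis treeT : spanning_tree G T.
Implicit Types (A B C D S : {set E}) (e f t s : E) (u v w : V).

Lemma tree_even_eq0 A : even_set G A -> A \subset T -> A = set0.
Proof.
move=> evA sAT; apply/eqP; apply: contraT => A0.
have [C cC sCA] := even_cycle_sub A0 evA.
by have /negP[] := treeT.2 _ cC; apply: subset_trans sAT.
Qed.

Lemma even_nontree_inj A B : even_set G A -> even_set G B ->
  A :\: T = B :\: T -> A = B.
Proof.
move=> evA evB /setP AB; apply: symdiff_eq0.
apply: tree_even_eq0 (even_symdiff evA evB) _; apply/subsetP => e.
rewrite in_symdiff; have := AB e; rewrite !inE.
by case: (e \in T) => //= ->; rewrite addbb.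
Qed.

(** The edges of a walk are added modulo 2, so an edge used twice cancels and the walk need not be a
    path. *)
Lemma connect_boundary u v S : connect (adjacent_in G S) u v ->
  exists2 A : {set E}, A \subset S &
             forall w, odd (degree_in G A w) = (u == w) (+) (v == w).
Proof.
case/connectP=> p; elim: p u => [|x p IHp] u /= => [_ ->|].
  by exists set0 => [|w]; rewrite ?sub0set // /degree_in big_set0 addbb.
case/andP=> /existsP[e /andP[eS ends_e]] /IHp{}IHp /IHp[A sA bdA].
exists (symdiff [set e] A) => [|w].
  by rewrite subUset !(subset_trans (subsetDl _ _)) ?sub1set.
rewrite odd_degree_symdiff bdA odd_degree1 odd_incidence addbA; congr (_ (+) _).
by case/orP: ends_e => /eqP -> /=; do 2 case: eqP => _.
Qed.

Lemma fundamental_even e : e \notin T ->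
  exists C : {set E}, [/\ even_set G C, C \subset e |: T & e \in C].
Proof.
move=> eT.
have [A sAT bdA] := connect_boundary (treeT.1 (ends G e).1 (ends G e).2).
exists (symdiff [set e] A); split.
- apply/forallP => w; rewrite odd_degree_symdiff bdA odd_degree1 odd_incidence.
  by rewrite addbb.
- rewrite subUset !(subset_trans (subsetDl _ _)) ?sub1set ?inE ?eqxx //.
  exact: subset_trans sAT (subsetUr _ _).
- by rewrite in_symdiff inE eqxx (contraNF (subsetP sAT e)).
Qed.

Lemma even_fundamental_mem e A : even_set G A -> A \subset e |: T ->
  A != set0 -> e \in A.
Proof.
move=> evA sA; apply: contraNT => eA; apply/eqP/tree_even_eq0 => //.
apply/subsetP => f fA; have := subsetP sA f fA; rewrite !inE => /orP[/eqP ef|//].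
by rewrite -ef fA in eA.
Qed.

(** A cycle in [e |: T] that avoids [e] would lie in [T]. For existence, a walk in [T] between the
    ends of [e], closed by [e], gives a nonempty even set, which contains a cycle. *)
Lemma ciP e : e \notin T ->
  [/\ is_cycle G (ci G T e), ci G T e \subset e |: T & e \in ci G T e].
Proof.
move=> eT; have [D [evD sD eD]] := fundamental_even eT.
have D0 : D != set0 by apply/set0Pn; exists e.
rewrite /ci; case: pickP => [C /andP[cC sC]|none] /=.
  split=> //; apply: even_fundamental_mem => //; first exact: cycle_even.
  by case/and3P: cC.
have [C cC sCD] := even_cycle_sub D0 evD.
by have := none C; rewrite /= cC (subset_trans sCD sD).
Qed.

Lemma ci_even e : e \notin T -> even_set G (ci G T e).
Proof. by move=> /ciP[/cycle_even]. Qed.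

Lemma ci_nontree e f : e \notin T -> f \notin T -> (f \in ci G T e) = (f == e).
Proof.
move=> eT fT; have [_ /subsetP sC eC] := ciP eT.
apply/idP/eqP => [/sC|-> //]; by rewrite !inE (negbTE fT) orbF => /eqP.
Qed.

Lemma ci_setDT e : e \notin T -> ci G T e :\: T = [set e].
Proof.
move=> eT; apply/setP => f; rewrite !inE andbC.
have [fT|fT] /= := boolP (f \in T); last by rewrite andbT ci_nontree.
by rewrite andbF; apply/esym; apply: contraNF eT => /eqP <-.
Qed.

Lemma ci_unique e A : e \notin T -> even_set G A -> A :\: T = [set e] ->
  A = ci G T e.
Proof.
move=> eT evA AT; apply: even_nontree_inj => //; first exact: ci_even.
by rewrite ci_setDT.
Qed.

Lemma in_ci2 e f s : (s \in ci2 G T e f) = (s \in ci G T e) (+) (s \in ci G T f).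
Proof. exact: in_symdiff. Qed.

Lemma ci2_setDT e f : e \notin T -> f \notin T -> e != f ->
  ci2 G T e f :\: T = [set e; f].
Proof.
move=> eT fT ef; apply/setP => s; rewrite !inE.
have [sT|sT] /= := boolP (s \in T).
  by apply/esym/norP; split; [apply: contraNneq eT|apply: contraNneq fT] => <-.
rewrite !ci_nontree //; case: (eqVneq s e) => [->|_] /=.
  by rewrite (negbTE ef).
by rewrite andbF.
Qed.

(* The shared tree edge t lies on both fundamental cycles but not on their
   symmetric difference, which therefore contains neither of the two. *)
Lemma ci2_cycle e f t : e \notin T -> f \notin T -> e != f ->
  t \in ci G T e -> t \in ci G T f -> is_cycle G (ci2 G T e f).
Proof.
move=> eT fT ef te tf.
have ev2 : even_set G (ci2 G T e f) by apply: even_symdiff; apply: ci_even.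
have DT := ci2_setDT eT fT ef.
have [|C cC sC] := even_cycle_sub _ ev2.
  by apply/set0Pn; exists e; rewrite in_ci2 !ci_nontree // eqxx (negbTE ef).
suff <- : C = ci2 G T e f by [].
have evC := cycle_even cC.
have sCT : C :\: T \subset [set e; f] by rewrite -DT setSD.
have tC : t \notin C.
  by apply/negP => /(subsetP sC); rewrite in_ci2 te tf.
apply: even_nontree_inj => //; rewrite DT; apply/eqP; rewrite eqEsubset sCT /=.
have neC : C :\: T != set0.
  apply/negP => /eqP CT; case/and3P: cC => /negP[]; apply/eqP.
  by apply: tree_even_eq0 => //; rewrite -setD_eq0 CT.
have H g h : (g == e) || (g == f) -> g \notin T ->
    C :\: T \subset [set g; h] -> t \in ci G T g -> h \in C :\: T.
  move=> _ gT sgh tg; apply: contraNT tC => hC; rewrite (ci_unique gT evC) //.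
  apply/eqP; rewrite eqEsubset; apply/andP; split.
    apply/subsetP => s sCs; have := subsetP sgh s sCs.
    by rewrite in_set2 => /orP[/eqP ->|/eqP sh]; [rewrite inE | rewrite -sh sCs in hC].
  rewrite sub1set; case/set0Pn: neC => s sCs; have := subsetP sgh s sCs.
  by rewrite in_set2 => /orP[/eqP <- //|/eqP sh]; rewrite -sh sCs in hC.
rewrite subUset !sub1set (H e f) ?eqxx // (H f e) ?eqxx ?orbT //.
by rewrite setUC.
Qed.

(** This is N t: the fundamental cut of the tree edge [t], without [t] itself. *)
Definition covering t := [set e | (e \notin T) && (t \in ci G T e)].

(** Modulo 2 an even set is the sum of the fundamental cycles of its nontree edges, so membership of
    [t] is the parity of the number of those that pass through [t]. The induction removes one
    nontree edge by adding its fundamental cycle. *)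
Lemma even_mem_tree C t : even_set G C -> t \in T ->
  (t \in C) = odd #|C :&: covering t|.
Proof.
move=> + tT; move: {2}#|_|.+1 (ltnSn #|C :\: T|) => k.
elim: k C => // k IHk C; rewrite ltnS => leC evC.
have [/eqP CT|/set0Pn[e]] := boolP (C :\: T == set0).
  have -> : C = set0 by apply: tree_even_eq0 => //; rewrite -setD_eq0 CT.
  by rewrite set0I cards0 inE.
rewrite inE => /andP[eT eC].
pose D := symdiff C (ci G T e).
have DT : D :\: T = (C :\: T) :\ e.
  apply/setP => f; rewrite !inE.
  have [//|fT] /= := boolP (f \in T); first by rewrite andbF.
  rewrite !ci_nontree //; case: (eqVneq f e) => [->|_] /=; rewrite ?eC //.
  by case: (f \in C).
have DN : D :&: covering t = (C :&: covering t) :\ e.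
  apply/setP => f; have /setP/(_ f) := DT; rewrite !inE.
  case: (f \in T) => /=; first by rewrite !andbF.
  by case: (t \in ci G T f); rewrite ?andbF ?andbT.
have -> : (t \in C) = (t \in D) (+) (t \in ci G T e).
  by rewrite in_symdiff -addbA addbb addbF.
rewrite (IHk D) ?DN; last by apply: even_symdiff (ci_even eT).
  rewrite [in RHS](cardsD1 e) !inE eC eT /= oddD oddb addbC.
  by [].
rewrite DT; apply: leq_trans leC; apply: proper_card.
by apply: properD1; rewrite inE eT.
Qed.
End SpanningTree.

(** * Bases of the cycle lattice *)

Section Lattice.
Variable E : finType.
Implicit Types (B : {set {set E}}) (C : {set E}) (x y : {ffun E -> int}).
Import GRing.Theory Num.Theory Order.TTheory.
Local Open Scope ring_scope.

Lemma ffunMzE x (z : int) e : (x *~ z) e = x e * z.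
Proof.
case: z => k; first by rewrite -pmulrn ffunMnE -mulr_natr natz.
by rewrite NegzE mulrNz ffunE -pmulrn ffunMnE mulrN -mulr_natr natz.
Qed.

Lemma lattice_chi B C : C \in B -> lattice B (chi C).
Proof.
move=> BC; exists (fun D => (D == C)%:Z).
rewrite (bigD1 C) //= eqxx mulr1z big1 ?addr0 // => D /andP[_ /negbTE ->].
by rewrite mulr0z.
Qed.

Lemma lattice0 B : lattice B 0.
Proof. by exists (fun=> 0); rewrite big1 // => C _; rewrite mulr0z. Qed.

Lemma latticeD B x y : lattice B x -> lattice B y -> lattice B (x + y).
Proof.
move=> [c ->] [d ->]; exists (fun C => c C + d C).
by rewrite -big_split; apply: eq_bigr => C _; rewrite mulrzDr.
Qed.

Lemma latticeMz B x z : lattice B x -> lattice B (x *~ z).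
Proof.
move=> [c ->]; exists (fun C => c C * z); rewrite mulrz_suml.
by apply: eq_bigr => C _; rewrite mulrzA.
Qed.

Lemma latticeB B x y : lattice B x -> lattice B y -> lattice B (x - y).
Proof.
by move=> Bx By; rewrite -[y]mulr1z -mulrNz; apply: latticeD (latticeMz _ _).
Qed.

Lemma lattice_sum B (I : finType) (P : pred I) (F : I -> {ffun E -> int}) :
  (forall i, P i -> lattice B (F i)) -> lattice B (\sum_(i | P i) F i).
Proof.
by move=> PB; apply: (big_ind (lattice B)) => //; [apply: lattice0|apply: latticeD].
Qed.

Lemma lattice_trans B B' x :
  (forall C, C \in B -> lattice B' (chi C)) -> lattice B x -> lattice B' x.
Proof. by move=> BB' [c ->]; apply: lattice_sum => C /BB'; apply: latticeMz. Qed.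
End Lattice.

Section Basis.
Variables (V E : finType) (G : mgraph V E) (T R : {set E}) (x y : E -> E).
Hypothesis treeT : spanning_tree G T.
Implicit Types (C : {set E}) (e f t s : E).
Import GRing.Theory Num.Theory Order.TTheory.
Local Notation ci := (ci G T).
Local Notation covering := (covering G T).

Hypothesis R_tree : {subset R <= T}.
Hypothesis xy_cover :
  {in R, forall t, [/\ x t \in covering t, y t \in covering t & x t != y t]}.
Hypothesis xy_min : {in R & T, forall t s,
  x t \in covering s -> y t \in covering s -> covering t \subset covering s}.
Hypothesis R_rep :
  {in T, forall t, 1 < #|covering t| -> exists2 i, i \in R & covering i = covering t}.
Hypothesis R_inj : {in R &, injective covering}.

(** By the hypotheses above, [R] is a transversal of the classes of tree edges with equal [covering]
    of size at least two, so there is one semi-fundamental cycle per class. *)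
Definition pair_basis : {set {set E}} :=
  [set ci e | e in ~: T] :|: [set ci2 G T (x t) (y t) | t in R].

Let coverP t e : (e \in covering t) = (e \notin T) && (t \in ci e).
Proof. by rewrite inE. Qed.

Let xyP t : t \in R ->
  [/\ x t \notin T, y t \notin T, x t != y t, t \in ci (x t) & t \in ci (y t)].
Proof.
by move=> /xy_cover[]; rewrite !coverP => /andP[? ?] /andP[? ?] ?; split.
Qed.

Let xy_in t s : t \in R -> s \in T ->
  (s \in ci (x t)) && (s \in ci (y t)) = (covering t \subset covering s).
Proof.
move=> tR sT; have [xT yT _ _ _] := xyP tR.
apply/andP/idP => [[sx sy]|/subsetP sub].
  by apply: xy_min => //; rewrite coverP ?xT ?yT.
have [/sub + /sub + _] := xy_cover tR.
by rewrite !coverP => /andP[_ ->] /andP[_ ->].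
Qed.

Let basis_ci e : e \notin T -> ci e \in pair_basis.
Proof. by move=> eT; apply/setUP; left; apply/imsetP; exists e; rewrite ?inE. Qed.

Let basis_ci2 t : t \in R -> ci2 G T (x t) (y t) \in pair_basis.
Proof. by move=> tR; apply/setUP; right; apply/imsetP; exists t. Qed.

Local Open Scope ring_scope.

(** With a and b the indicators of the two fundamental cycles at s, the left side is a + b - (a xor
    b) = 2ab. Off [T] the two cycles are disjoint; on [T] the choice of the pair makes ab the
    indicator of [covering t \subset covering s]. *)
Lemma two_chi_above t : t \in R ->
  chi (ci (x t)) + chi (ci (y t)) - chi (ci2 G T (x t) (y t)) =
  [ffun s => ((s \in T) && (covering t \subset covering s))%:R *+ 2] :> {ffun E -> int}.
Proof.
move=> tR; have [xT yT xy tx ty] := xyP tR.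
apply/ffunP => s; rewrite !ffunE in_ci2.
have [sT|sT] /= := boolP (s \in T); last first.
  rewrite !ci_nontree //; case: (eqVneq s (x t)) => [->|_] /=.
    by rewrite (negbTE xy).
  by case: eqP.
rewrite -xy_in //.
by case: (s \in ci (x t)); case: (s \in ci (y t)).
Qed.

(* Downward induction on k: subtracting the multiples of the vectors of
   two_chi_above kills the classes covered exactly k times and changes only
   classes covered more often. *)
Lemma lattice_two_class (g : E -> int) :
  {in T &, forall t s, covering t = covering s -> g t = g s} ->
  {in T, forall t, (#|covering t| <= 1)%N -> g t = 0} ->
  lattice pair_basis [ffun t => if t \in T then g t *+ 2 else 0].
Proof.
suff H j k : (#|E| <= k + j)%N -> (0 < k)%N ->
    {in T &, forall t s, covering t = covering s -> g t = g s} ->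
    {in T, forall t, (#|covering t| <= k)%N -> g t = 0} ->
    lattice pair_basis [ffun t => if t \in T then g t *+ 2 else 0].
  by move=> gN; apply: (H #|E| 1%N) => //; rewrite leq_addl.
elim: j k g => [|j IHj] k g leE k0 gN g0.
  rewrite [X in lattice _ X](_ : _ = 0); first exact: lattice0.
  apply/ffunP => t; rewrite !ffunE; case: ifP => // /g0 ->; rewrite ?mul0rn //.
  by apply: leq_trans (max_card _) _; rewrite -[k]addn0.
pose P i := (i \in R) && (#|covering i| == k.+1).
pose h s : int := g s - \sum_(i | P i) g i * (covering i \subset covering s)%:R.
have /IHj : (#|E| <= k.+1 + j)%N by rewrite addSnnS.
move=> /(_ h isT) IH.
pose z := \sum_(i | P i) (chi (ci (x i)) + chi (ci (y i))
                         - chi (ci2 G T (x i) (y i))) *~ g i.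
rewrite [X in lattice _ X](_ : _ =
    [ffun t => if t \in T then h t *+ 2 else 0] + z); last first.
  apply/ffunP => t; rewrite [in RHS]ffunE /z sum_ffunE.
  under eq_bigr => i /andP[iR _] do rewrite two_chi_above // ffunMzE ffunE.
  rewrite !ffunE /h; case: (t \in T) => /=.
    rewrite mulrnBl -[LHS](subrK (\sum_(i | P i)
      g i * (covering i \subset covering t)%:R *+ 2)).
    rewrite sumrMnl; congr (_ + _); rewrite -sumrMnl.
    by apply: eq_bigr => i _; rewrite mulrnAl mulrC.
  by rewrite add0r big1 // => i _; rewrite mul0rn mul0r.
apply: latticeD; last first.
  apply: lattice_sum => i /andP[iR _]; have [xT yT _ _ _] := xyP iR.
  apply: latticeMz; apply: latticeB; last exact/lattice_chi/basis_ci2.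
  by apply: latticeD; apply: lattice_chi; apply: basis_ci.
apply: IH => [t s tT sT ts|t tT].
  rewrite /h (gN t s) //; congr (_ - _).
  by apply: eq_bigr => i _; rewrite ts.
rewrite leq_eqVlt => /orP[/eqP tk|]; last first.
  rewrite ltnS => tk; rewrite /h g0 // sub0r; apply/eqP.
  rewrite oppr_eq0 big1 // => i /andP[_ /eqP ik].
  case: (boolP (_ \subset _)) => [/subset_leq_card|_]; last by rewrite mulr0.
  by rewrite ik ltnNge tk.
(* At an edge whose class has size [k.+1] only its own representative contributes to the sum,
   because inclusion between sets of equal size is equality. *)
have [|i iR it] := R_rep tT; first by rewrite tk.
rewrite /h (bigD1 i) /P ?iR ?it ?tk ?eqxx //= subxx mulr1 (gN i t) ?(R_tree iR) //.
rewrite big1 ?addr0 ?subrr // => l /andP[/andP[lR /eqP lk] li].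
case: (boolP (_ \subset _)) => [sub|_]; last by rewrite mulr0.
case/eqP: li; apply: R_inj => //; rewrite it; apply/eqP.
by rewrite eqEcard sub tk lk /=.
Qed.

Lemma pair_basis_cycles : pair_basis \subset cycles G.
Proof.
apply/subsetP => C; rewrite !inE => /orP[] /imsetP[e].
  by rewrite inE => eT ->; have [] := ciP treeT eT.
by move=> /xyP[xT yT xy tx ty] ->; apply: ci2_cycle tx ty.
Qed.

Lemma lattice_pair_basis C : is_cycle G C -> lattice pair_basis (chi C).
Proof.
(* At a tree edge t the fundamental cycles of the edges in [C :\: T] add up to
   [#|C :&: covering t|], of which [chi C] keeps only the parity; the difference is twice [g t]. *)
move=> cC; pose g t : int := (#|C :&: covering t|./2)%:Z.
have -> : chi C = \sum_(e in C :\: T) chi (ci e) -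
            [ffun t => if t \in T then g t *+ 2 else 0].
  apply/ffunP => s; rewrite !ffunE sum_ffunE.
  under eq_bigr => e _ do rewrite ffunE.
  rewrite -natr_sum; case: ifP => sT; last first.
    rewrite subr0; have [sC|sC] := boolP (s \in C).
      rewrite (bigD1 s) ?inE ?sC ?sT //= ci_nontree ?sT // eqxx.
      rewrite big1 // => e; rewrite !inE => /andP[/andP[eT _] /negbTE es].
      by rewrite ci_nontree ?sT // eq_sym es.
    rewrite big1 // => e; rewrite !inE => /andP[eT eC].
    rewrite ci_nontree ?sT //; case: eqP => // es; by rewrite es eC in sC.
  have -> : (\sum_(e in C :\: T) (s \in ci e))%N = #|C :&: covering s|.
    rewrite -sum1_card big_mkcond [RHS]big_mkcond /=; apply: eq_bigr => e _.
    rewrite !inE; case: (e \in T); rewrite ?andbF //=.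
    by case: (e \in C) => //=; case: (s \in _).
  rewrite (even_mem_tree treeT (cycle_even cC) sT) /g.
  by rewrite -{2}[#|C :&: _|]odd_double_half; lia.
apply: latticeB.
  by apply: lattice_sum => e; rewrite inE => /andP[eT _]; apply/lattice_chi/basis_ci.
apply: lattice_two_class => [t s _ _ ts|t tT tN]; rewrite /g ?ts //.
have : (#|C :&: covering t| <= 1)%N.
  by apply: leq_trans tN; apply/subset_leq_card/subsetIr.
by case: #|_| => [|[]].
Qed.

Lemma ci_inj : {in ~: T &, injective ci}.
Proof.
move=> e f; rewrite !inE => eT fT /(congr1 (fun C => C :\: T)).
by rewrite !ci_setDT // => /set1_inj.
Qed.

(** The nontree part of such a cycle is the pair itself. Equal pairs give inclusions of the covering
    sets both ways by [xy_min], and representatives with equal covering sets coincide. *)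
Lemma pair_cycle_inj : {in R &, injective (fun t => ci2 G T (x t) (y t))}.
Proof.
move=> t s tR sR; have [xT yT xy _ _] := xyP tR.
have [xT' yT' xy' _ _] := xyP sR.
move/(congr1 (fun C => C :\: T)); rewrite !ci2_setDT // => /setP ts.
apply: R_inj => //; have [tx ty _] := xy_cover tR; have [sx sy _] := xy_cover sR.
apply/eqP; rewrite eqEsubset; apply/andP; split; apply: xy_min; rewrite ?R_tree //.
- by have := ts (x t); rewrite !in_set2 eqxx => /esym/orP[] /eqP ->.
- by have := ts (y t); rewrite !in_set2 eqxx orbT => /esym/orP[] /eqP ->.
- by have := ts (x s); rewrite !in_set2 eqxx => /orP[] /eqP ->.
- by have := ts (y s); rewrite !in_set2 eqxx orbT => /orP[] /eqP ->.
Qed.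

Lemma ci_neq_pair_cycle e t : e \notin T -> t \in R -> ci e != ci2 G T (x t) (y t).
Proof.
move=> eT /xyP[xT yT xy _ _]; apply/eqP => /(congr1 (fun C => C :\: T)).
rewrite ci_setDT // ci2_setDT // => /(congr1 (fun C : {set E} => #|C|)).
by rewrite cards1 cards2 xy.
Qed.

Lemma big_pair_basis (M : nmodType) (F : {set E} -> M) :
  \sum_(C in pair_basis) F C =
  \sum_(e in ~: T) F (ci e) + \sum_(t in R) F (ci2 G T (x t) (y t)).
Proof.
rewrite -(big_imset _ ci_inj) -(big_imset _ pair_cycle_inj) /= -bigU /=.
  by apply: eq_bigl => C; rewrite [LHS]in_setU.
rewrite disjoints_subset; apply/subsetP => C /imsetP[e]; rewrite inE => eT ->.
by rewrite inE; apply/imsetP => -[t tR] /eqP; apply/negP/ci_neq_pair_cycle.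
Qed.

(** Evaluation at a nontree edge expresses the coefficient of its fundamental cycle by those of the
    pairs. Substituted at a tree edge s, this leaves -2 times the sum of the pair coefficients over
    all t with [covering t \subset covering s]; these coefficients vanish by induction on the size
    of the covering set. *)
Lemma pair_basis_free (c : {set E} -> int) :
  \sum_(C in pair_basis) chi C *~ c C = 0 -> {in pair_basis, forall C, c C = 0}.
Proof.
rewrite big_pair_basis => /ffunP sum0.
pose a e := c (ci e); pose b t := c (ci2 G T (x t) (y t)).
have eval s : \sum_(e in ~: T) (s \in ci e)%:R * a e +
              \sum_(t in R) (s \in ci2 G T (x t) (y t))%:R * b t = 0.
  have := sum0 s; rewrite !ffunE !sum_ffunE => H; rewrite -[RHS]H.
  congr (_ + _).
    by apply: eq_bigr => e _; rewrite ffunMzE ffunE.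
  by apply: eq_bigr => e _; rewrite ffunMzE ffunE.
have aE e : e \notin T ->
    a e = - \sum_(t in R) ((e == x t)%:R + (e == y t)%:R) * b t.
  move=> eT; apply: subr0_eq; rewrite opprK -[RHS](eval e).
  congr (_ + _).
    rewrite (bigD1 e) ?inE //= ci_nontree // eqxx mul1r big1 ?addr0 // => f.
    rewrite inE => /andP[fT]; rewrite ci_nontree // eq_sym => /negbTE ->.
    by rewrite mul0r.
  apply: eq_bigr => t tR; have [xT yT xy _ _] := xyP tR.
  rewrite in_ci2 !ci_nontree //; congr (_ * _).
  case: (eqVneq e (x t)) => [->|_] /=; first by rewrite (negbTE xy).
  by rewrite add0r.
have b_above s : s \in T -> \sum_(t in R) (covering t \subset covering s)%:R * b t = 0.
  move=> sT; have := eval s.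
  under eq_bigr => e eT.
    rewrite aE -?in_setC // mulrN mulr_sumr; over.
  rewrite sumrN exchange_big /= addrC -sumrB.
  (* With a and b the indicators of s in the two fundamental cycles of the pair, (a xor b) - (a + b)
     = -2ab. *)
  rewrite (eq_bigr (fun t => (covering t \subset covering s)%:R * b t * - 2)).
    by rewrite -mulr_suml => /eqP; rewrite mulf_eq0 orbF => /eqP.
  move=> t tR; have [xT yT _ _ _] := xyP tR.
  under [X in _ - X]eq_bigr => e _ do rewrite mulrA mulrDr.
  rewrite -mulr_suml big_split /= -mulrBl mulrAC; congr (_ * _).
  have pick z : z \notin T ->
      \sum_(e in ~: T) (s \in ci e)%:R * (e == z)%:R = (s \in ci z)%:R :> int.
    move=> zT; rewrite (bigD1 z) ?inE //= eqxx mulr1 big1 ?addr0 // => e.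
    by case/andP=> _ /negbTE ->; rewrite mulr0.
  rewrite !pick // in_ci2 -xy_in //.
  by case: (s \in ci (x t)); case: (s \in ci (y t)).
have b0 t : t \in R -> b t = 0.
  move: {2}#|_|.+1 (ltnSn #|covering t|) => k; elim: k t => // k IHk t.
  rewrite ltnS => tk tR; rewrite -[RHS](b_above t) ?R_tree //.
  rewrite (bigD1 t) //= subxx mul1r big1 ?addr0 // => s /andP[sR st].
  case: (boolP (_ \subset _)) => [sub|_]; last by rewrite mul0r.
  rewrite mul1r; apply: IHk => //; apply: leq_trans tk; apply: proper_card.
  rewrite properEneq sub andbT; apply: contraNneq st => ts.
  by apply/eqP; apply: R_inj.
move=> C; rewrite in_setU => /orP[] /imsetP[e].
  rewrite inE => eT ->; rewrite -[LHS]/(a e) aE // big1 ?oppr0 // => t tR.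
  by rewrite b0 // mulr0.
by move=> eR ->; apply: b0.
Qed.

Theorem pair_basis_semi_fundamental : semi_fundamental_basis G T pair_basis.
Proof.
split; last 1 first.
- move=> C; rewrite in_setU => /orP[] /imsetP[e]; rewrite ?inE => eR ->.
    by left; exists e.
  right; have [xT yT xy tx ty] := xyP eR; exists (x e), (y e); split=> //.
  by apply/set0Pn; exists e; rewrite !inE tx ty R_tree.
- split; [exact: pair_basis_cycles| |exact: pair_basis_free].
  move=> z; split; apply: lattice_trans => C.
    by rewrite inE => /lattice_pair_basis.
  by move/(subsetP pair_basis_cycles)/lattice_chi.
- exact: basis_ci.
Qed.
End Basis.

(** * Tree paths in preorder *)

Section Laminar.
Variables (n : nat) (l : nat -> nat).

Definition inside i p := (i <= p) && (p < l i).

Definition crossing i (e : nat * nat) := inside i e.1 (+) inside i e.2.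

Definition laminar :=
  (forall i, 0 < i < n -> i < l i <= n) /\
  (forall i j, 0 < i < j -> j < n -> j < l i -> l j <= l i).

(** The distance from [t] back to [p] around the cycle of [n] positions, with values from 1 to [n].
    The subtree of [t] gets the largest keys, so for an edge crossing [t] the larger key belongs to
    the end inside and the smaller to the end outside, without a test of which is which. *)
Definition cyclic_key t p := if p < t then t - p else n - (p - t).

Definition high_key t (e : nat * nat) := maxn (cyclic_key t e.1) (cyclic_key t e.2).
Definition low_key t (e : nat * nat) := minn (cyclic_key t e.1) (cyclic_key t e.2).

Hypothesis lam : laminar.

Lemma crossing_ends t e : crossing t e -> exists a b,
  [/\ inside t a, ~~ inside t b,
      forall s, crossing s e = inside s a (+) inside s b
    & (a = e.1 /\ b = e.2) \/ (a = e.2 /\ b = e.1)].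
Proof.
rewrite /crossing; case E1: (inside t e.1); case E2: (inside t e.2) => // _.
  by exists e.1, e.2; split; rewrite ?E1 ?E2 //; left.
by exists e.2, e.1; split; rewrite ?E1 ?E2 //; [move=> s; rewrite addbC | right].
Qed.

(** The subtree of a vertex below [t] lies within that of [t], so it can contain only the inner end
    of an edge crossing [t]. *)
Lemma crossing_inner t s a b : 0 < t < n -> t < s < l t ->
  inside t a -> ~~ inside t b -> inside s a (+) inside s b = inside s a.
Proof.
move=> t0 /andP[ts st]; have := lam.1 _ t0; have := lam.2 t s; rewrite /inside; lia.
Qed.

(** Here the subtree of [s] either contains that of [t] or is disjoint from it, so it does not
    distinguish inner ends, and only the outer end matters. *)
Lemma crossing_outer t s a : 0 < t < n -> 0 < s < n -> s != t ->
  ~~ (t < s < l t) -> inside t a -> inside s a = inside s t.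
Proof.
move=> t0 s0 st nst; have := lam.1 _ t0; have := lam.1 _ s0.
have := lam.2 s t; rewrite /inside; lia.
Qed.

Lemma inside_nested s s' p : 0 < s < n -> 0 < s' < n ->
  inside s p -> inside s' p ->
  (forall q, inside s q -> inside s' q) \/ (forall q, inside s' q -> inside s q).
Proof.
move=> s0 s0'; have := lam.2 s s'; have := lam.2 s' s; rewrite /inside.
case: (ltngtP s s') => ss' l1 l2 H H'; last by left=> q; rewrite ss'.
- by right=> q; lia.
- by left=> q; lia.
Qed.

(* Seen from an edge t, the far sides of two other tree edges on the same side
   of t are nested or disjoint. *)
Lemma far_sides_laminar t s s' e f g :
  0 < t < n -> 0 < s < n -> 0 < s' < n ->
  (t < s < l t) = (t < s' < l t) ->
  crossing t e -> crossing t f -> crossing t g ->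
  crossing s e -> crossing s' e ->
  crossing s f -> ~~ crossing s' f -> crossing s' g -> ~~ crossing s g -> False.
Proof.
move=> t0 s0 s0' side /crossing_ends[a [b [ta tb ce _]]].
move=> /crossing_ends[a' [b' [ta' tb' cf _]]].
move=> /crossing_ends[a'' [b'' [ta'' tb'' cg _]]].
rewrite !ce !cf !cg.
have [st|st] := eqVneq s t.
  by rewrite st ta'' (negbTE tb'').
have [st'|st'] := eqVneq s' t.
  by rewrite st' ta' (negbTE tb').
have [ins|outs] := boolP (t < s < l t).
  have ins' : t < s' < l t by rewrite -side.
  rewrite !(@crossing_inner t s) // !(@crossing_inner t s') //.
  move=> sa s'a sa' /negP s'a' s'a'' /negP sa''.
  by have [sub|sub] := inside_nested s0 s0' sa s'a; [apply/s'a'/sub|apply/sa''/sub].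
have outs' : ~~ (t < s' < l t) by rewrite -side.
rewrite !(@crossing_outer t s a) // !(@crossing_outer t s' a) //.
rewrite !(@crossing_outer t s a') // !(@crossing_outer t s' a') //.
rewrite !(@crossing_outer t s a'') // !(@crossing_outer t s' a'') //.
have nest := inside_nested s0 s0'.
case E: (inside s t); case E': (inside s' t) => /=.
- case: (nest _ E E') => sub.
    by move=> _ _ _ /negbNE /negP + /negP s'b'' /negbNE /sub.
  by move=> _ _ /negP sb' /negbNE /sub.
- move=> sb s'b _ _ s'b'' /negbNE sb''.
  case: (nest _ sb'' s'b'') => sub; first by rewrite sub in E'.
  by rewrite (sub _ s'b) in sb.
- move=> sb s'b sb' /negbNE s'b' _ _.
  case: (nest _ sb' s'b') => sub; last by rewrite sub in E.
  by rewrite (sub _ sb) in s'b.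
- move=> sb s'b sb' /negP s'b' s'b'' /negP sb''.
  by case: (nest _ sb s'b) => sub; [apply/s'b'/sub|apply/sb''/sub].
Qed.

(* The two directions in which a path can leave t leave no room for three tree
   edges pairwise on different sides. *)
Lemma crossing_merge t e f g :
  0 < t < n -> crossing t e -> crossing t f -> crossing t g ->
  (exists2 s, 0 < s < n & [&& crossing s e, crossing s f & ~~ crossing s g]) ->
  (exists2 s, 0 < s < n & [&& crossing s g, crossing s e & ~~ crossing s f]) ->
  forall s, 0 < s < n -> crossing s g -> crossing s f -> crossing s e.
Proof.
move=> t0 te tf tg [s1 s10 /and3P[s1e s1f s1g]] [s2 s20 /and3P[s2g s2e s2f]].
move=> s s0 sg sf; apply: contraT => se; exfalso.
(* Each of [s1], [s2], [s] lies on exactly two of the three paths and misses a different one. Two of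
   these tree edges are on the same side of [t], where nested or disjoint far sides exclude this
   pattern. *)
have [E|N1] := eqVneq (t < s1 < l t) (t < s2 < l t).
  exact: (@far_sides_laminar t s1 s2 e f g).
have [E|N2] := eqVneq (t < s1 < l t) (t < s < l t).
  exact: (@far_sides_laminar t s1 s f e g).
have E : (t < s2 < l t) = (t < s < l t).
  by case: (t < s1 < l t) N1 N2; case: (t < s2 < l t); case: (t < s < l t).
exact: (@far_sides_laminar t s2 s g e f).
Qed.

(** If [s] is below [t], its subtree is an interval in the keys of inner ends, and [e1], [e2]
    enclose the inner end of [e]. Otherwise its far side, the subtree of [s] or the complement if
    [s] is above [t], is an interval in the keys of outer ends, where [f1], [f2] enclose the outer
    end of [e]. *)
Lemma extreme_crossing t s e1 e2 f1 f2 e :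
  0 < t < n -> 0 < s < n ->
  (forall g, g \in [:: e1; e2; f1; f2; e] ->
     [/\ g.1 < n, g.2 < n & crossing t g]) ->
  high_key t e1 <= high_key t e <= high_key t e2 ->
  low_key t f1 <= low_key t e <= low_key t f2 ->
  crossing s e1 -> crossing s e2 -> crossing s f1 -> crossing s f2 ->
  crossing s e.
Proof.
move=> t0 s0 ok.
have keys g : g \in [:: e1; e2; f1; f2; e] -> exists a b,
    [/\ inside t a, ~~ inside t b, a < n, b < n &
      [/\ forall s, crossing s g = inside s a (+) inside s b,
      high_key t g = n - (a - t) & low_key t g = cyclic_key t b]].
  case/ok => g1 g2 /crossing_ends[a [b [ta tb cs ab]]]; exists a, b.
  split=> //; [by case: ab => -[-> _]|by case: ab => -[_ ->]|split=> //].
    case: ab ta tb => [[-> ->]|[-> ->]]; rewrite /inside /high_key /cyclic_key.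
      by have := lam.1 _ t0; case: ifP; case: ifP; lia.
    by have := lam.1 _ t0; case: ifP; case: ifP; lia.
  case: ab ta tb => [[-> ->]|[-> ->]]; rewrite /inside /low_key /cyclic_key.
    by have := lam.1 _ t0; case: ifP; case: ifP; lia.
  by have := lam.1 _ t0; case: ifP; case: ifP; lia.
have [|a1 [b1 [ta1 tb1 na1 nb1 [ce1 -> _]]]] := keys e1; first by rewrite !inE eqxx.
have [|a2 [b2 [ta2 tb2 na2 nb2 [ce2 -> _]]]] := keys e2; first by rewrite !inE eqxx ?orbT.
have [|a3 [b3 [ta3 tb3 na3 nb3 [cf1 _ ->]]]] := keys f1; first by rewrite !inE eqxx ?orbT.
have [|a4 [b4 [ta4 tb4 na4 nb4 [cf2 _ ->]]]] := keys f2; first by rewrite !inE eqxx ?orbT.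
have [|a [b [ta tb na nb [ce -> ->]]]] := keys e; first by rewrite !inE eqxx ?orbT.
rewrite ce1 ce2 cf1 cf2 ce.
have [->|st] := eqVneq s t; first by rewrite ta (negbTE tb).
have lt := lam.1 _ t0; have ls := lam.1 _ s0.
have [ins|outs] := boolP (t < s < l t).
  rewrite !(@crossing_inner t s) //; move: ta ta1 ta2; rewrite /inside; lia.
rewrite (@crossing_outer t s a) // (@crossing_outer t s a1) //.
rewrite (@crossing_outer t s a2) // (@crossing_outer t s a3) //.
rewrite (@crossing_outer t s a4) // => _.
move: tb tb3 tb4 {keys ok ta ta1 ta2 ta3 ta4 tb1 tb2 ce ce1 ce2 cf1 cf2}.
move=> tb tb3 tb4 /andP[le3 le4] _ _.
case E: (inside s t) => /= sb3 sb4.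
  have [sltt ltls] : s < t /\ l t <= l s.
    by have := lam.2 s t; move: E; rewrite /inside; lia.
  apply/negP => sb; have [btl|tbl] := ltnP b t.
    by move: le3 sb sb3; rewrite /cyclic_key btl /inside; case: ltnP; lia.
  move: le4 sb sb4 tb; rewrite /cyclic_key [b < t]ltnNge tbl /inside /=.
  by case: ltnP; lia.
have [lst|lts] : l s <= t \/ l t <= s.
- by have := lam.2 t s; move: E outs; rewrite /inside; lia.
- have b3t : b3 < t by move: sb3; rewrite /inside; lia.
  have b4t : b4 < t by move: sb4; rewrite /inside; lia.
  move: le3 le4 sb3 sb4; rewrite /cyclic_key b3t b4t /inside.
  by case: ltnP; lia.
have b3t : t <= b3 by move: sb3; rewrite /inside; lia.
have b4t : t <= b4 by move: sb4; rewrite /inside; lia.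
move: le3 le4 sb3 sb4; rewrite /cyclic_key ![_ < t]ltnNge b3t b4t /inside /=.
by case: (leqP t b) => /=; lia.
Qed.

(* Vertices are numbered in preorder, and the subtree of i is [i, l i[. *)
Definition subtree_ends (par : nat -> nat) := forall i, 0 < i < n ->
  [/\ i < l i <= n, forall k, i < k < l i -> i <= par k
    & l i < n -> par (l i) < i].
End Laminar.

(** The second condition says that no vertex strictly between [par j] and [j] is the parent of a
    vertex after [j]; this makes the descendants of a vertex contiguous. *)
Definition preorder n (par : nat -> nat) :=
  (forall j, 0 < j < n -> par j < j) /\
  (forall j k, 0 < j < k -> k < n -> par k < j -> par k <= par j).

Lemma subtree_endsP n par : exists l, subtree_ends n l par.
Proof.
exists (fun i => i.+1 + find (fun k => par k < i) (iota i.+1 (n - i.+1))).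
move=> i /andP[i0 ltin]; set s := iota _ _; set P := fun k => par k < i.
have sz : size s = n - i.+1 by rewrite size_iota.
have le : find P s <= n - i.+1 by rewrite -sz find_size.
split; first by rewrite addSn ltnS leq_addr /=; lia.
  move=> k /andP[ik klt]; rewrite leqNgt.
  have nthk : nth 0 s (k - i.+1) = k by rewrite nth_iota ?subnKC; lia.
  by apply/negP => lt; have /negP[] := @before_find _ 0 P s (k - i.+1) ltac:(lia); rewrite nthk.
move=> lt; have hs : has P s by rewrite has_find sz; lia.
have := nth_find 0 hs; rewrite {1}/s nth_iota //; lia.
Qed.

Section Subtrees.
Variables (n : nat) (par l : nat -> nat).
Hypotheses (pre : preorder n par) (sub : subtree_ends n l par).

Lemma subtrees_laminar : laminar n l.
Proof.
split=> [i /sub[] //|i j /andP[i0 ij] jn jl].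
have i0n : 0 < i < n by lia.
have j0n : 0 < j < n by lia.
have [lti subi parli] := sub i0n; have [ltj subj parlj] := sub j0n.
rewrite leqNgt; apply/negP => lij.
have := subj (l i); lia.
Qed.

(** A child [j] of a vertex of [i, l i[ cannot come after [l i]: preorder would give
    [par j <= par (l i) < i]. *)
Lemma inside_par i j : 0 < i < n -> 0 < j < n -> i != j ->
  inside l i j = inside l i (par j).
Proof.
move=> i0 j0 ij; have [lti subi parli] := sub i0; have pj := pre.1 _ j0.
rewrite /inside; apply/idP/idP => H; first by have := subi j; lia.
have lij : i < j by lia.
rewrite (ltnW lij) /=; rewrite ltnNge; apply/negP => lji.
have [e|ne] := eqVneq (l i) j; first by rewrite e in parli H; lia.
have := pre.2 (l i) j; lia.
Qed.

Lemma inside_self i : 0 < i < n -> inside l i i && ~~ inside l i (par i).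
Proof.
by move=> i0; have [lti _ _] := sub i0; have := pre.1 _ i0; rewrite /inside; lia.
Qed.

Lemma crossing_tree i j : 0 < i < n -> 0 < j < n ->
  crossing l i (j, par j) = (j == i).
Proof.
move=> i0 j0; rewrite /crossing /=; case: (eqVneq j i) => [->|ji].
  by have /andP[-> /negbTE ->] := inside_self i0.
by rewrite inside_par 1?eq_sym // addbb.
Qed.
End Subtrees.

(** * Depth-first search *)

Section Search.
Variables (V E : finType) (G : mgraph V E) (S : {set E}).
Implicit Types (T : {set E}) (pos : V -> nat) (par : nat -> nat) (ch : E -> nat).

Definition end_positions pos e := (pos (ends G e).1, pos (ends G e).2).

(* State of a depth-first search of (V, S) after k visits: vertices get their
   visiting time as position, unvisited ones #|V|; the tree edge e links the
   vertex at position [ch e] to its parent, and par_max records that each visit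
   extended the latest vertex that could be extended. *)
Record search_state T pos par ch k : Prop := SearchState {
  pos_dom : forall v, pos v < k \/ pos v = #|V|;
  pos_inj : forall u v, pos u < k -> pos u = pos v -> u = v;
  pos_onto : forall i, i < k -> exists v, pos v = i;
  par_lt : forall j, 0 < j < k -> par j < j;
  tree_sub : T \subset S;
  tree_ends : {in T, forall e, 0 < ch e < k /\
    (end_positions pos e = (ch e, par (ch e)) \/
     end_positions pos e = (par (ch e), ch e))};
  ch_inj : {in T &, injective ch};
  ch_onto : forall j, 0 < j < k -> exists2 e, e \in T & ch e = j;
  par_max : forall j e, 0 < j < k -> e \in S ->
    (pos (ends G e).1 < j <= pos (ends G e).2 -> pos (ends G e).1 <= par j) /\
    (pos (ends G e).2 < j <= pos (ends G e).1 -> pos (ends G e).2 <= par j) }.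

Lemma search_start r :
  search_state set0 (fun v => if v == r then 0 else #|V|) (fun=> 0) (fun=> 0) 1.
Proof.
have V0 : 0 < #|V| by apply/card_gt0P; exists r.
split=> [v|u v|i|j|||||j e]; rewrite ?sub0set //; try (by move=> e; rewrite inE);
  try lia.
- by case: ifP; [left|right].
- by case: eqP => [->|_]; [move=> _; case: eqP => // _; lia | lia].
- by case: i => // _; exists r; rewrite eqxx.
Qed.

(** The last hypothesis makes [x] the latest visited vertex that can still be extended; this is what
    [par_max] demands of the new position [k]. *)
Lemma search_step T pos par ch k e x y :
  search_state T pos par ch k -> 0 < k < #|V| ->
  e \in S -> ends G e = (x, y) \/ ends G e = (y, x) ->
  pos x < k <= pos y ->
  (forall f, f \in S ->
    (pos (ends G f).1 < k <= pos (ends G f).2 -> pos (ends G f).1 <= pos x) /\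
    (pos (ends G f).2 < k <= pos (ends G f).1 -> pos (ends G f).2 <= pos x)) ->
  search_state (e |: T) (fun v => if v == y then k else pos v)
    (fun j => if j == k then pos x else par j)
    (fun f => if f == e then k else ch f) k.+1.
Proof.
move=> st kV eS exy /andP[xk ky] mx.
have y_new : pos y = #|V| by case: (pos_dom st y) => //; lia.
have xy : x != y by apply: contraTneq xk => ->; lia.
have eT : e \notin T.
  apply/negP => /(tree_ends st)[chk]; have := par_lt st chk.
  by rewrite /end_positions; case: exy => -> /= ? [] [? ?]; lia.
have oldpos v : pos v < k -> v != y by apply: contraTneq => ->; lia.
split=> [v|u v|i ik|j jk||f|f g|j jk|j f jk fS].
- by case: eqP => _; [left|case: (pos_dom st v); [left; lia|right]].
- have [->|uy] := eqVneq u y; have [->|vy] := eqVneq v y => //.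
  + by move=> _ kv; case: (pos_dom st v); lia.
  + by move=> _ uk; case: (pos_dom st u); lia.
  + move=> uk; apply: (pos_inj st); have := pos_dom st u; lia.
- have [->|ik'] := eqVneq i k; first by exists y; rewrite eqxx.
  have [|v vi] := pos_onto st (i := i); first by lia.
  by exists v; rewrite (negbTE (oldpos v _)) // vi; lia.
- have [->|jk'] := eqVneq j k; first by [].
  by apply: (par_lt st); lia.
- by rewrite subUset sub1set eS (tree_sub st).
- rewrite 2!inE; have [->|fe] /= := eqVneq f e.
    move=> _; rewrite eqxx; split; first by lia.
    rewrite /end_positions; case: exy => -> /=; rewrite eqxx (negbTE xy).
      by right.
    by left.
  move=> /(tree_ends st)[chk].
  have ne : ch f != k by apply/eqP; lia.
  rewrite (negbTE ne) /end_positions => ends_f; split; first by lia.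
  have := par_lt st chk; case: ends_f => -[p1 p2] lt.
    by rewrite (negbTE (oldpos _ _)) ?p1 ?(negbTE (oldpos _ _)) ?p2; [left|lia|lia].
  by rewrite (negbTE (oldpos _ _)) ?p1 ?(negbTE (oldpos _ _)) ?p2; [right|lia|lia].
- rewrite !in_setU1; have [->|fe] := eqVneq f e; have [->|ge] //= := eqVneq g e.
  + by move=> _ /(tree_ends st)[chk _]; lia.
  + by move=> /(tree_ends st)[chk _] _; lia.
  + exact: (ch_inj st).
- have [->|jk'] := eqVneq j k; first by exists e; rewrite ?setU11 ?eqxx.
  have [|f fT chf] := ch_onto st (j := j); first by lia.
  exists f; first by rewrite in_setU1 fT orbT.
  by case: eqP => // fe; rewrite -fe fT in eT.
- have [jk'|jk'] := eqVneq j k.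
    have [m1 m2] := mx f fS; rewrite jk'; split.
      case: eqP => _; first by lia.
      case: eqP => [e2|_] H; apply: m1; rewrite ?e2; lia.
    case: eqP => _; first by lia.
    case: eqP => [e2|_] H; apply: m2; rewrite ?e2; lia.
  have [|m1 m2] := par_max st (j := j) _ fS; first by lia.
  split.
    case: eqP => _; first by lia.
    case: eqP => [e2|_] H; apply: m1; rewrite ?e2; lia.
  case: eqP => _; first by lia.
  case: eqP => [e2|_] H; apply: m2; rewrite ?e2; lia.
Qed.

Lemma connect_crossing (r : rel V) (P : pred V) u v :
  connect r u v -> P u -> ~~ P v -> exists x y, [/\ r x y, P x & ~~ P y].
Proof.
case/connectP=> p; elim: p u => [|x p IHp] u /= => [_ -> Pu /negP //|].
case/andP=> ux xp lastv Pu Pv; have [Px|nPx] := boolP (P x); last by exists u, x.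
exact: IHp xp lastv Px Pv.
Qed.

Lemma adjacent_inP (A : {set E}) u v : reflect
  (exists2 e, e \in A & ends G e = (u, v) \/ ends G e = (v, u))
  (adjacent_in G A u v).
Proof.
apply: (iffP existsP) => [[e /andP[eA /orP[]/eqP eE]]|[e eA eE]].
- by exists e; [|left].
- by exists e; [|right].
- by exists e; rewrite eA; case: eE => ->; rewrite eqxx ?orbT.
Qed.

Hypothesis connS : forall u v, connect (adjacent_in G S) u v.

Lemma search_frontier T pos par ch k : search_state T pos par ch k ->
  0 < k < #|V| ->
  exists e x y, [/\ e \in S, ends G e = (x, y) \/ ends G e = (y, x)
                  & pos x < k <= pos y].
Proof.
move=> st kV; have [|r r0] := pos_onto st (i := 0); first by lia.
have [v vk] : exists v, k <= pos v.
  apply/existsP; apply: contraT; rewrite negb_exists => /forallP all_lt.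
  have lt v : pos v < k by rewrite ltnNge.
  have : injective (fun v => Ordinal (lt v)).
    by move=> u v [/(pos_inj st (lt u))].
  by move/leq_card; rewrite card_ord; lia.
have [||x [y [/adjacent_inP[e eS exy] xk yk]]] :=
  @connect_crossing _ (fun v => pos v < k) _ _ (connS r v).
- by rewrite r0; lia.
- by rewrite -leqNgt.
by exists e, x, y; split=> //; rewrite xk leqNgt.
Qed.

Lemma search_exists k : 0 < k <= #|V| ->
  exists T pos par ch, search_state T pos par ch k.
Proof.
elim: k => // k IHk /andP[_ kV]; have [->|k0] := posnP k.
  have /card_gt0P[r _] : 0 < #|V| by lia.
  by do 4 eexists; apply: search_start r.
have [|T [pos [par [ch st]]]] := IHk; first by lia.
pose P (z : E * (V * V)) := [&& z.1 \in S,
  (ends G z.1 == z.2) || (ends G z.1 == (z.2.2, z.2.1))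
  & pos z.2.1 < k <= pos z.2.2].
have [|e0 [x0 [y0 [e0S e0xy xk0]]]] := search_frontier st; first by lia.
have P0 : P (e0, (x0, y0)).
  by rewrite /P /= e0S xk0 andbT; case: e0xy => ->; rewrite eqxx ?orbT.
case: (arg_maxnP (fun z : E * (V * V) => pos z.2.1) P0) => -[e [x y]].
rewrite /P /= => /and3P[eS exy xk] mx.
do 4 eexists; apply: (search_step (e := e) (x := x) (y := y) st) => //.
- lia.
- by case/orP: exy => /eqP; [left|right].
move=> f fS; split=> H.
  by apply: (mx (f, ((ends G f).1, (ends G f).2))); rewrite /P /= fS H -surjective_pairing eqxx.
by apply: (mx (f, ((ends G f).2, (ends G f).1))); rewrite /P /= fS H -surjective_pairing eqxx orbT.
Qed.
End Search.

Section SearchTree.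
Variables (V E : finType) (G : mgraph V E) (S T : {set E}).
Variables (pos : V -> nat) (par : nat -> nat) (ch : E -> nat) (l : nat -> nat).
Local Notation n := #|V|.
Local Notation endp := (end_positions G pos).
Hypothesis st : search_state G S T pos par ch n.
Hypothesis sub : subtree_ends n l par.

(** A vertex still at position n, together with the n positions already taken, would give n + 1
    distinct values on n vertices. *)
Lemma search_pos_lt v : pos v < n.
Proof.
case: (pos_dom st v) => // vn.
have : size (iota 0 n.+1) <= size [seq pos u | u <- enum V].
  apply: uniq_leq_size (iota_uniq _ _) _ => i; rewrite mem_iota add0n ltnS /=.
  rewrite leq_eqVlt => /orP[/eqP ->|/(pos_onto st)[u <-]].
    by rewrite -vn map_f ?mem_enum.
  by rewrite map_f ?mem_enum.
by rewrite size_iota size_map -cardE ltnn.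
Qed.

(** The second condition is [par_max] applied to the tree edge that joins [k] to its parent. *)
Lemma search_preorder : preorder n par.
Proof.
split=> [j|j k jk kn pk]; first by move=> j0; apply: (par_lt st j0).
have k0 : 0 < k < n by lia.
have [e eT ek] := ch_onto st k0.
have [|m1 m2] := par_max st (j := j) _ (subsetP (tree_sub st) e eT); first by lia.
have [_] := tree_ends st eT; rewrite /end_positions ek.
by case=> -[p1 p2]; [apply: (leq_trans _ (m2 _))|apply: (leq_trans _ (m1 _))]; lia.
Qed.

Lemma crossing_tree_edge e f : e \in T -> f \in T ->
  crossing l (ch e) (endp f) = (f == e).
Proof.
move=> eT fT; have [che _] := tree_ends st eT; have [chf ends_f] := tree_ends st fT.
have -> : crossing l (ch e) (endp f) = crossing l (ch e) (ch f, par (ch f)).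
  by case: ends_f => -> //; rewrite /crossing addbC.
rewrite (crossing_tree search_preorder sub) //.
by apply/eqP/eqP => [/(ch_inj st)|->] //; apply.
Qed.

Let subtree i := [set v | inside l i (pos v)].

Let subtree_cut i f :
  ((ends G f).1 \in subtree i) (+) ((ends G f).2 \in subtree i) =
  crossing l i (endp f).
Proof. by rewrite !inE. Qed.

(** Following parents leads to the root. A cycle inside [T] would meet the cut around a subtree in
    the single tree edge above it, against [even_cut]. *)
Lemma search_tree : spanning_tree G T.
Proof.
have conn v : exists2 r, pos r = 0 & connect (adjacent_in G T) r v.
  move: {2}(pos v).+1 (ltnSn (pos v)) => k; elim: k v => // k IHk v.
  rewrite ltnS => vk; have [v0|v0] := posnP (pos v); first by exists v.
  have chv : 0 < pos v < n by rewrite v0 search_pos_lt.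
  have [e eT ev] := ch_onto st chv.
  have [_] := tree_ends st eT; rewrite /end_positions ev => ends_e.
  have [u uE adj] : exists2 u, pos u = par (pos v) & adjacent_in G T u v.
    case: ends_e => -[p1 p2].
      have ve := pos_inj st (search_pos_lt _) p1.
      exists (ends G e).2 => //; apply/adjacent_inP; exists e => //.
      by right; rewrite -[in RHS]ve -surjective_pairing.
    have ve := pos_inj st (search_pos_lt _) p2.
    exists (ends G e).1 => //; apply/adjacent_inP; exists e => //.
    by left; rewrite -[in RHS]ve -surjective_pairing.
  have [|r r0 ru] := IHk u; first by rewrite uE; have := par_lt st chv; lia.
  by exists r => //; apply: connect_trans ru (connect1 adj).
have symT : connect_sym (adjacent_in G T).
  apply: sym_connect_sym => u v; apply/adjacent_inP/adjacent_inP;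
  by case=> e eT eE; exists e => //; case: eE; [right|left].
split=> [u v|C cC].
  have [r r0 ru] := conn u; have [r' r0' rv] := conn v.
  have rr : r = r' by apply: pos_inj st _ _ _ _; rewrite ?search_pos_lt // r0.
  by apply: connect_trans (_ : connect _ u r) _; [rewrite symT|rewrite rr].
apply/negP => sCT; have /and3P[/set0Pn[e0 e0C] _ _] := cC.
case: (arg_maxnP ch e0C) => e eC mx.
have eT := subsetP sCT e eC; have [che _] := tree_ends st eT.
have := even_cut (subtree (ch e)) (cycle_even cC).
rewrite (bigD1 e) //= big1 => [|f /andP[fC fe]].
  by rewrite subtree_cut crossing_tree_edge // eqxx.
rewrite subtree_cut crossing_tree_edge //; first exact: negbTE.
exact: (subsetP sCT).
Qed.

(** The cycle meets the cut around the subtree below [t] evenly, and of its edges only [t] and [e]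
    can cross that cut. *)
Lemma in_ci_crossing t e : t \in T -> e \notin T ->
  (t \in ci G T e) = crossing l (ch t) (endp e).
Proof.
move=> tT eT; have [cC /subsetP sC eC] := ciP search_tree eT.
have := even_cut (subtree (ch t)) (cycle_even cC).
rewrite (bigD1 e) //= subtree_cut.
have crE f : f \in ci G T e -> f != e ->
    ((ends G f).1 \in subtree (ch t)) (+) ((ends G f).2 \in subtree (ch t))
    = (f == t).
  move=> fC fe; rewrite subtree_cut; apply: crossing_tree_edge => //.
  by have := sC f fC; rewrite in_setU1 (negbTE fe).
have te : t != e by apply: contraNneq eT => <-.
have [tC|tC] := boolP (t \in ci G T e).
  rewrite (bigD1 t) /=; last by rewrite tC.
  rewrite crE // eqxx big1 => [|f /andP[/andP[fC fe] ft]].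
    by case: (crossing _ _ _).
  by rewrite crE // (negbTE ft).
rewrite big1 ?addbF // => f /andP[fC fe]; rewrite crE //.
by apply: contraNF tC => /eqP <-.
Qed.

Lemma in_covering t e : t \in T ->
  (e \in covering G T t) = (e \notin T) && crossing l (ch t) (endp e).
Proof.
by move=> tT; rewrite inE; have [//|eT] := boolP (e \in T); rewrite in_ci_crossing.
Qed.

End SearchTree.

(** * Choice of the pairs *)

Section PairSelection.
Variables (n : nat) (l : nat -> nat) (I : eqType) (P : I -> nat * nat).
Variable nontree : pred I.
Implicit Types (e f g x y : I) (t s : nat).

Definition in_cover t e := nontree e && crossing l t (P e).

(* The fundamental cycles of x and y share exactly the tree edges whose
   covering sets contain that of t. *)
Definition tight_pair t x y := [/\ in_cover t x, in_cover t y, x != y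
  & forall s, 0 < s < n -> crossing l s (P x) -> crossing l s (P y) ->
    forall e, in_cover t e -> crossing l s (P e)].

Definition apart e f g :=
  has (fun s => [&& crossing l s (P e), crossing l s (P f)
                  & ~~ crossing l s (P g)]) (iota 1 n.-1).

Lemma apartP e f g : reflect
  (exists2 s, 0 < s < n & [&& crossing l s (P e), crossing l s (P f)
                          & ~~ crossing l s (P g)]) (apart e f g).
Proof.
by apply: (iffP hasP) => -[s si sP]; exists s => //; move: si; rewrite mem_iota; lia.
Qed.

(** Of three paths through a common tree edge, two are kept whose intersection lies in the third. If
    both tests find a separating tree edge, [crossing_merge] guarantees that the remaining pair
    works. *)
Definition merge_pair g (xy : I * I) :=
  if apart xy.1 xy.2 g then if apart g xy.1 xy.2 then (g, xy.2) else (xy.1, g)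
  else xy.

Hypothesis lam : laminar n l.
Hypothesis P_lt : forall e, nontree e -> (P e).1 < n /\ (P e).2 < n.

Lemma merge_pairP t g xy : 0 < t < n -> in_cover t g ->
  in_cover t xy.1 -> in_cover t xy.2 -> xy.1 != xy.2 ->
  let xy' := merge_pair g xy in
  [/\ in_cover t xy'.1, in_cover t xy'.2, xy'.1 != xy'.2
    & forall s, 0 < s < n -> crossing l s (P xy'.1) -> crossing l s (P xy'.2) ->
      [/\ crossing l s (P xy.1), crossing l s (P xy.2) & crossing l s (P g)]].
Proof.
case: xy => x y /= t0 tg tx ty xy; rewrite /merge_pair /=.
case: (apartP x y g) => [A|nA]; last first.
  split=> // s s0 sx sy; split=> //; apply: contraT => sg.
  by case: nA; exists s; rewrite ?sx ?sy.
case: (apartP g x y) => [B|nB]; split=> //=.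
- by case: A => s _ /and3P[_ sy sg]; apply: contraNneq sg => ->.
- move=> s s0 sg sy; split=> //; move: s s0 sg sy.
  by apply: (crossing_merge lam t0) => //;
    [case/andP: tx|case/andP: ty|case/andP: tg].
- by case: A => s _ /and3P[sx _ sg]; apply: contraNneq sg => <-.
- move=> s s0 sx sg; split=> //; apply: contraT => sy.
  by case: nB; exists s; rewrite ?sx ?sg.
Qed.

Definition extreme_edges t e1 e2 f1 f2 :=
  [/\ in_cover t e1, in_cover t e2, in_cover t f1, in_cover t f2
    & forall e, in_cover t e ->
      [/\ high_key n t (P e1) <= high_key n t (P e),
          high_key n t (P e) <= high_key n t (P e2),
          low_key n t (P f1) <= low_key n t (P e)
        & low_key n t (P e) <= low_key n t (P f2)]].

(** The intersection of the pair after a merge lies in that of the pair before it and in the merged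
    path. Hence the tree edges common to the final pair lie on all four extreme paths, and
    [extreme_crossing] puts them on every path through [t]. *)
Lemma merge_extremes t e1 e2 f1 f2 : 0 < t < n ->
  extreme_edges t e1 e2 f1 f2 -> e1 != e2 ->
  let xy := merge_pair f2 (merge_pair f1 (e1, e2)) in tight_pair t xy.1 xy.2.
Proof.
move=> t0 [te1 te2 tf1 tf2 ext] ne /=.
have [] := merge_pairP (xy := (e1, e2)) t0 tf1 te1 te2 ne.
move: (merge_pair f1 _) => xy tx ty nexy sub1.
have [tx' ty' nexy' sub2] := merge_pairP t0 tf2 tx ty nexy.
split=> // s s0 sx' sy' e te.
have [sx sy sf2] := sub2 s s0 sx' sy'; have [se1 se2 sf1] := sub1 s s0 sx sy.
have [h1 h2 h3 h4] := ext e te.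
apply: (extreme_crossing lam (t := t) (e1 := P e1) (e2 := P e2)
  (f1 := P f1) (f2 := P f2)) => //; rewrite ?h1 ?h3 // => g.
have ok h : in_cover t h -> [/\ (P h).1 < n, (P h).2 < n & crossing l t (P h)].
  by case/andP=> /P_lt[].
by rewrite !inE => /or4P[||| /orP[]] /eqP ->; apply: ok.
Qed.
End PairSelection.

Lemma tight_pair_exists n l (I : finType) (P : I -> nat * nat) (nontree : pred I) t :
  laminar n l -> (forall e, nontree e -> (P e).1 < n /\ (P e).2 < n) ->
  0 < t < n -> 1 < #|[set e | in_cover l P nontree t e]| ->
  exists x y, tight_pair n l P nontree t x y.
Proof.
move=> lam Plt t0 gt1; set N := [set e | _] in gt1.
have /card_gt0P[e0 e0N] : 0 < #|N| by lia.
case: (arg_minnP (fun e => high_key n t (P e)) e0N) => e1 e1N min1.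
(* [e2] is taken maximal among the edges other than [e1] to keep the two distinct; it is still an
   overall maximum because [e1] is a minimum. *)
have /card_gt0P[e0' e0N'] : 0 < #|N :\ e1|.
  by move: gt1; rewrite (cardsD1 e1) (e1N : e1 \in N); lia.
case: (arg_maxnP (fun e => high_key n t (P e)) e0N') => e2.
case/setD1P=> e21 e2N max2.
case: (arg_minnP (fun e => low_key n t (P e)) e0N) => f1 f1N min3.
case: (arg_maxnP (fun e => low_key n t (P e)) e0N) => f2 f2N max4.
have NE e : e \in N -> in_cover l P nontree t e by rewrite inE.
have ext : extreme_edges n l P nontree t e1 e2 f1 f2.
  split; try by apply: NE.
  move=> e te; have eN : e \in N by rewrite inE.
  split; [exact: min1| |exact: min3|exact: max4].
  have [->|ee1] := eqVneq e e1; first exact: min1.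
  by apply/max2/setD1P.
by do 2 eexists; apply: merge_extremes ext _; rewrite // eq_sym.
Qed.

(** * The basis belonging to a search tree *)

Section SearchBasis.
Variables (V E : finType) (G : mgraph V E) (S T : {set E}).
Variables (pos : V -> nat) (par : nat -> nat) (ch : E -> nat) (l : nat -> nat).
Local Notation n := #|V|.
Local Notation covers := (in_cover l (end_positions G pos) (fun e => e \notin T)).
Local Notation tight_pair := (tight_pair n l (end_positions G pos) (fun e => e \notin T)).
Hypothesis st : search_state G S T pos par ch n.
Hypothesis sub : subtree_ends n l par.

Lemma coveringE t : t \in T -> covering G T t = [set e | covers (ch t) e].
Proof. by move=> tT; apply/setP => e; rewrite (in_covering st sub) // inE. Qed.

Section PairBasis.
Variables (R : {set E}) (x y : E -> E).
Hypothesis R_tree : {subset R <= T}.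
Hypothesis xyR : {in R, forall t, tight_pair (ch t) (x t) (y t)}.
Hypothesis R_rep : {in T, forall t, 1 < #|[set e | covers (ch t) e]| ->
  exists2 i, i \in R & covers (ch i) =1 covers (ch t)}.
Hypothesis R_inj : {in R &, forall t s, covers (ch t) =1 covers (ch s) -> t = s}.

Let xy_cover :
  {in R, forall t, [/\ x t \in covering G T t, y t \in covering G T t & x t != y t]}.
Proof. by move=> t tR; have [cx cy xy _] := xyR tR; rewrite coveringE ?inE ?R_tree. Qed.

Let xy_min : {in R & T, forall t s, x t \in covering G T s ->
  y t \in covering G T s -> covering G T t \subset covering G T s}.
Proof.
move=> t s tR sT; have [_ _ _ m] := xyR tR.
have [s0 _] := tree_ends st sT; have inc := in_covering st sub.
rewrite !inc // => /andP[_ sx] /andP[_ sy]; apply/subsetP => e.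
rewrite !inc ?(R_tree tR) // => te; have /andP[eT _] := te.
by rewrite eT (m _ s0).
Qed.

Let rep : {in T, forall t, 1 < #|covering G T t| ->
  exists2 i, i \in R & covering G T i = covering G T t}.
Proof.
move=> t tT; rewrite coveringE // => /(R_rep tT)[i iR it]; exists i => //.
by rewrite coveringE ?R_tree //; apply/setP => e; rewrite !inE it.
Qed.

Let inj : {in R &, injective (covering G T)}.
Proof.
move=> t s tR sR; rewrite !coveringE ?R_tree // => /setP ts; apply: R_inj => // e.
by have := ts e; rewrite !inE.
Qed.

Theorem search_basis : semi_fundamental_basis G T (pair_basis G T R x y).
Proof. exact: pair_basis_semi_fundamental (search_tree st sub) _ _ _ _ _. Qed.

Lemma search_pair_inj : {in R &, injective (fun t => ci2 G T (x t) (y t))}.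
Proof. exact: pair_cycle_inj (search_tree st sub) _ _ _ _. Qed.

Lemma search_ci_neq e t : e \notin T -> t \in R -> ci G T e != ci2 G T (x t) (y t).
Proof. by apply: ci_neq_pair_cycle (search_tree st sub) _ _ _. Qed.
End PairBasis.

Theorem search_basis_exists : exists B, semi_fundamental_basis G T B.
Proof.
have lam := subtrees_laminar sub.
have plt e : e \notin T -> (end_positions G pos e).1 < n /\ (end_positions G pos e).2 < n.
  by move=> _; split; apply: search_pos_lt st _.
pose N t := [set e | covers (ch t) e].
pose R := [set t in T | (1 < #|N t|) &&
                        [forall s in T, (N s == N t) ==> (ch t <= ch s)]].
have RT : {subset R <= T} by move=> t; rewrite inE => /andP[].
have sel t : exists xy : E * E, t \in R -> tight_pair (ch t) xy.1 xy.2.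
  have [|_] := boolP (t \in R); last by exists (t, t).
  rewrite inE => /and3P[tT N2 _]; have [ch0 _] := tree_ends st tT.
  by have [x [y xy]] := tight_pair_exists lam plt ch0 N2; exists (x, y).
have [xy xyP] := fin_all_exists sel.
exists (pair_basis G T R (fun t => (xy t).1) (fun t => (xy t).2)).
apply: search_basis => //.
  move=> t tT N2; have P0 : (t \in T) && (N t == N t) by rewrite tT eqxx.
  case: (@arg_minnP _ t (fun s => (s \in T) && (N s == N t)) ch P0).
  move=> i /andP[iT /eqP iN] mn; exists i.
    rewrite inE iT iN N2; apply/forallP => s; apply/implyP => sT; apply/implyP => sN.
    by apply: mn; rewrite sT.
  by move=> e; have /setP/(_ e) := iN; rewrite !inE.
move=> t s; rewrite !inE => /and3P[tT _ /forallP tm] /and3P[sT _ /forallP sm] ts.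
have NN : N t = N s by apply/setP => e; rewrite !inE ts.
have := tm s; rewrite sT NN eqxx /=; have := sm t; rewrite tT NN eqxx /=.
by move=> le1 le2; apply: (ch_inj st) => //; apply/eqP; rewrite eqn_leq le1 le2.
Qed.
End SearchBasis.

(** An edge of [T] outside [T'] would close a cycle within [T]. Hence a search confined to the edges
    of a prescribed tree returns that very tree. *)
Lemma spanning_tree_sub (V E : finType) (G : mgraph V E) (T T' : {set E}) :
  spanning_tree G T -> spanning_tree G T' -> T' \subset T -> T' = T.
Proof.
move=> treeT treeT' sub; apply/eqP; rewrite eqEsubset sub; apply/subsetP => e eT.
apply: contraT => eT'; have [cC sC _] := ciP treeT' eT'.
have /negP[] := treeT.2 _ cC; apply: subset_trans sC _.
by rewrite subUset sub1set eT.
Qed.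

Theorem basis_exists (V E : finType) (G : mgraph V E) (S : {set E}) :
  0 < #|V| -> (forall u v, connect (adjacent_in G S) u v) ->
  exists (T : {set E}) (B : {set {set E}}), [/\ T \subset S, spanning_tree G T & semi_fundamental_basis G T B].
Proof.
move=> V0 conn; have [|T [pos [par [ch st]]]] := search_exists conn (k := #|V|).
  by rewrite V0 leqnn.
have [l sub] := subtree_endsP #|V| par.
have [B bB] := search_basis_exists st sub.
exists T, B; split=> //; [exact: tree_sub st|exact: search_tree st sub].
Qed.

Theorem semi_fundamental_basis_exists (V E : finType) (G : mgraph V E) (T : {set E}) :
  0 < #|V| -> spanning_tree G T -> exists B, semi_fundamental_basis G T B.
Proof.
move=> V0 treeT; have [T' [B [sub treeT' bB]]] := basis_exists V0 treeT.1.
by exists B; rewrite -(spanning_tree_sub treeT treeT' sub).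
Qed.

(** * Running times of programs *)

Definition runs (p : program) (s : state) (b : nat) (Q : state -> Prop) :=
  exists t s', [/\ exec p s t s', t <= b & Q s'].

Fixpoint written_regs (p : program) : seq nat :=
  match p with
  | Skip | SetCell _ _ _ => [::]
  | SetReg r _ => [:: r]
  | Seq p q | If _ p q => written_regs p ++ written_regs q
  | While _ p => written_regs p
  end.

Fixpoint written_arrs (p : program) : seq nat :=
  match p with
  | Skip | SetReg _ _ => [::]
  | SetCell a _ _ => [:: a]
  | Seq p q | If _ p q => written_arrs p ++ written_arrs q
  | While _ p => written_arrs p
  end.

(** The bound on what changes is read off the text of the program, so that loop invariants need only
    mention what the body assigns. *)
Definition frame (p : program) (s s' : state) :=
  (forall r, r \notin written_regs p -> reg s' r = reg s r) /\
  (forall a, a \notin written_arrs p -> forall i, arr s' a i = arr s a i).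

Lemma frame_refl p s : frame p s s. Proof. by []. Qed.

Lemma frame_sub p q s s' :
  {subset written_regs p <= written_regs q} ->
  {subset written_arrs p <= written_arrs q} -> frame p s s' -> frame q s s'.
Proof.
by move=> sr sa [fr fa]; split=> [r|a] nq; [apply: fr|apply: fa]; apply: contra nq;
  [apply: sr|apply: sa].
Qed.

Lemma frame_trans p s1 s2 s3 : frame p s1 s2 -> frame p s2 s3 -> frame p s1 s3.
Proof.
move=> [fr fa] [gr ga]; split=> [r nr|a na i]; first by rewrite gr ?fr.
by rewrite ga ?fa.
Qed.

Lemma exec_frame p s t s' : exec p s t s' -> frame p s s'.
Proof.
elim=> {p s t s'} //=.
- by move=> s r x; split=> // r' /=; rewrite inE => /negbTE ->.
- by move=> s a i x; split=> // a' /=; rewrite inE => /negbTE ->.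
- move=> p q s t s' t' s'' _ fp _ fq.
  by apply: frame_trans (frame_sub _ _ fp) (frame_sub _ _ fq) => /= r H;
    rewrite mem_cat H ?orbT.
- move=> x p q s t s' _ _; apply: frame_sub => r H /=; by rewrite mem_cat H.
- move=> x p q s t s' _ _; apply: frame_sub => r H /=; by rewrite mem_cat H orbT.
- by move=> x p s t s' t' s'' _ _ fp _; apply: frame_trans.
Qed.

Lemma runs_frame p s b Q : runs p s b Q -> runs p s b (fun s' => frame p s s' /\ Q s').
Proof.
by move=> [t [s' [ex tb Qs]]]; exists t, s'; split=> //; split=> //; apply: exec_frame ex.
Qed.

Lemma runs_weaken p s b b' (Q Q' : state -> Prop) :
  runs p s b Q -> b <= b' -> (forall s', frame p s s' -> Q s' -> Q' s') -> runs p s b' Q'.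
Proof.
move=> /runs_frame[t [s' [ex tb [fr Qs]]]] bb' QQ'.
by exists t, s'; split; [|apply: leq_trans bb'|apply: QQ'].
Qed.

Lemma runs_seq p q s b b' (R Q : state -> Prop) :
  runs p s b R -> (forall s', frame p s s' -> R s' -> runs q s' b' Q) ->
  runs (Seq p q) s (b + b') Q.
Proof.
move=> /runs_frame[t [s' [ex tb [fr Rs]]]] /(_ s' fr Rs)[t' [s'' [ex' tb' Qs]]].
by exists (t + t'), s''; split=> //; [apply: ExecSeq ex'|apply: leq_add].
Qed.

Lemma runs_if x p q s b Q :
  (eval s x != 0 -> runs p s b Q) -> (eval s x = 0 -> runs q s b Q) ->
  runs (If x p q) s b.+1 Q.
Proof.
move=> Ht Hf; have [x0|x0] := eqVneq (eval s x) 0.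
  case: (Hf x0) => t [s' [ex tb Qs]].
  by exists t.+1, s'; split=> //; apply: ExecIfFalse.
case: (Ht x0) => t [s' [ex tb Qs]].
by exists t.+1, s'; split=> //; apply: ExecIfTrue.
Qed.

Fixpoint loop_free p :=
  match p with
  | Seq p q | If _ p q => loop_free p && loop_free q
  | While _ _ => false
  | _ => true
  end.

Fixpoint run p s :=
  match p with
  | SetReg r x => set_reg s r (eval s x)
  | SetCell a i x => set_cell s a (eval s i) (eval s x)
  | Seq p q => run q (run p s)
  | If x p q => if eval s x != 0 then run p s else run q s
  | _ => s
  end.

Fixpoint cost p :=
  match p with
  | Seq p q => cost p + cost q
  | If _ p q => (maxn (cost p) (cost q)).+1
  | _ => 1
  end.

Lemma runs_loop_free p s b (Q : state -> Prop) :
  loop_free p -> cost p <= b -> Q (run p s) -> runs p s b Q.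
Proof.
move=> lf cb Qs; suff [t [s' [ex tb e]]] : runs p s (cost p) (fun s' => s' = run p s).
  by exists t, s'; split=> //; [apply: leq_trans cb|rewrite e].
elim: p s lf {b Q cb Qs} => //=.
- by exists 1, s; split=> //; apply: ExecSkip.
- by move=> r x s; exists 1, (run (SetReg r x) s); split=> //; apply: ExecSetReg.
- by move=> a i x s; exists 1, (run (SetCell a i x) s); split=> //; apply: ExecSetCell.
- move=> p IHp q IHq s /andP[lp lq]; apply: runs_seq (IHp s lp) _ => s' _ ->.
  exact: IHq.
- move=> x p IHp q IHq s /andP[lp lq]; apply: runs_if => [->|-> /=].
    by apply: (runs_weaken (IHp s lp)); rewrite ?leq_maxl.
  by apply: (runs_weaken (IHq s lq)); rewrite ?leq_maxr.
Qed.

(** The index of the invariant counts the iterations that remain; entering the body with none left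
    has to be contradictory. *)
Lemma runs_while x p s N b (I : nat -> state -> Prop) (Q : state -> Prop) :
  I N s ->
  (forall k s', I k s' -> frame p s s' -> eval s' x != 0 ->
     if k is j.+1 then runs p s' b (I j) else False) ->
  (forall k s', I k s' -> frame p s s' -> eval s' x = 0 -> Q s') ->
  runs (While x p) s (N * b.+1).+1 Q.
Proof.
move=> IN step stop.
suff H k s' : I k s' -> frame p s s' -> runs (While x p) s' (k * b.+1).+1 Q.
  exact: H (frame_refl _ _).
elim: k s' => [|k IHk] s' Ik fr; have [x0|x0] := eqVneq (eval s' x) 0.
- by exists 1, s'; split=> //; [apply: ExecWhileFalse|apply: stop Ik fr x0].
- by case: (step _ _ Ik fr x0).
- by exists 1, s'; split=> //; [apply: ExecWhileFalse|apply: stop Ik fr x0].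
have [t [s1 [ex tb [fr1 I1]]]] := runs_frame (step _ _ Ik fr x0).
have [t' [s2 [ex' tb' Qs]]] := IHk s1 I1 (frame_trans fr fr1).
exists (t + t').+1, s2; split=> //; first exact: ExecWhileTrue x0 ex ex'.
by rewrite mulSn; lia.
Qed.

Definition for_loop r a x p :=
  Seq (SetReg r a) (While (Less (Reg r) x) (Seq p (SetReg r (Succ (Reg r))))).

(** Besides [b], an iteration pays for the test and the increment; the final 2 are the
    initialisation and the last test. The loop is charged [N] iterations wherever it starts, and
    [maxn] covers a start beyond [N]. *)
Lemma runs_for r a x p s N b (I : nat -> state -> Prop) (Q : state -> Prop) :
  (forall s', frame (for_loop r a x p) s s' -> eval s' x = N) ->
  r \notin written_regs p ->
  I (eval s a) (set_reg s r (eval s a)) ->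
  (forall k s', eval s a <= k < N -> frame (for_loop r a x p) s s' ->
     reg s' r = k -> I k s' ->
     runs p s' b (fun s'' => I k.+1 (set_reg s'' r k.+1))) ->
  (forall s', frame (for_loop r a x p) s s' -> I (maxn (eval s a) N) s' -> Q s') ->
  runs (for_loop r a x p) s (N * (b + 2) + 2) Q.
Proof.
move=> xN rp I0 step stop; set a0 := eval s a in I0 step stop *.
have sub s0 s' : frame (Seq p (SetReg r (Succ (Reg r)))) s0 s' ->
    frame (for_loop r a x p) s0 s'.
  by apply: frame_sub => z H //=; rewrite inE H orbT.
pose J k s' := [/\ k = N - reg s' r, a0 <= reg s' r, reg s' r <= maxn a0 N & I (reg s' r) s'].
apply: (@runs_weaken _ _ (1 + (N * (b + 1).+1).+1) _ Q) => //; last by lia.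
apply: (@runs_seq _ _ _ _ _ (fun s' => s' = set_reg s r a0)).
  by exists 1, (set_reg s r a0); split=> //; apply: ExecSetReg.
move=> s1 _ ->.
have frs : frame (for_loop r a x p) s (set_reg s r a0).
  by split=> // z; rewrite /= inE negb_or => /andP[/negbTE ->].
apply: (@runs_weaken _ _ ((N - a0) * (b + 1).+1).+1 _ Q) => //; last first.
  by rewrite ltnS leq_mul2r leq_subr orbT.
apply: (runs_while (I := J)).
- by split; rewrite /= eqxx ?leqnn ?leq_maxl.
- move=> k s' [kE ar rm Ir] fr; have fr' := frame_trans frs (sub _ _ fr).
  rewrite /= (xN _ fr') eqb0 negbK => lt.
  case: k kE => [|k] kE; first by lia.
  apply: runs_seq (runs_frame (step _ s' _ fr' erefl Ir)) _.
    by rewrite ar.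
  move=> s2 _ [fr2 I2].
  have r2 : reg s2 r = reg s' r by apply: fr2.1.
  apply: runs_loop_free => //=; rewrite r2; split=> //=; rewrite eqxx //; lia.
- move=> k s' [kE ar rm Ir] fr; have fr' := frame_trans frs (sub _ _ fr).
  rewrite /= (xN _ fr') => /eqP; rewrite eqb0 => lt; apply: stop fr' _.
  by rewrite (_ : maxn a0 N = reg s' r) //; lia.
Qed.

(** * The program *)

(* Register 3 is the length of the output array 5; besides the finished lists
   ll, that array ends with the unfinished list c. *)
Definition outputs (s : state) (ll : seq (seq nat)) (c : seq nat) :=
  [/\ reg s 2 = size ll, forall i, i <= size ll -> arr s 4 i = offsets ll i,
      reg s 3 = size (flatten ll ++ c)
    & forall i, i < size (flatten ll ++ c) -> arr s 5 i = nth 0 (flatten ll ++ c) i].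

Definition push x := Seq (SetCell 5 (Reg 3) x) (SetReg 3 (Succ (Reg 3))).
Definition close_list := Seq (SetReg 2 (Succ (Reg 2))) (SetCell 4 (Reg 2) (Reg 3)).

Lemma outputs_eq s s' ll c :
  reg s' 2 = reg s 2 -> reg s' 3 = reg s 3 -> arr s' 4 =1 arr s 4 ->
  arr s' 5 =1 arr s 5 -> outputs s ll c -> outputs s' ll c.
Proof.
move=> r2 r3 a4 a5 [o2 o4 o3 o5]; split; rewrite ?r2 ?r3 // => i ilt.
  by rewrite a4 o4.
by rewrite a5 o5.
Qed.

Lemma outputs_frame p s s' ll c : frame p s s' ->
  2 \notin written_regs p -> 3 \notin written_regs p ->
  4 \notin written_arrs p -> 5 \notin written_arrs p ->
  outputs s ll c -> outputs s' ll c.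
Proof. by move=> [fr fa] *; apply: outputs_eq; rewrite ?fr //; apply: fa. Qed.

Lemma outputs_push s ll c x : outputs s ll c ->
  outputs (run (push x) s) ll (rcons c (eval s x)).
Proof.
move=> [o2 o4 o3 o5]; split=> //=.
  by rewrite o3 !size_cat size_rcons addnS.
move=> i; rewrite -rcons_cat size_rcons ltnS nth_rcons o3.
by case: ltngtP => // ilt _; apply: o5.
Qed.

Lemma offsets_rcons (T : Type) (ll : seq (seq T)) c i :
  offsets (rcons ll c) i =
  if i <= size ll then offsets ll i else size (flatten ll) + size c.
Proof.
rewrite /offsets map_rcons; case: leqP => ilt.
  by rewrite -cats1 takel_cat // size_map.
rewrite take_oversize ?size_rcons ?size_map // sumn_rcons -size_flatten //.
Qed.

Lemma outputs_close s ll c : outputs s ll c ->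
  outputs (run close_list s) (rcons ll c) [::].
Proof.
move=> [o2 o4 o3 o5]; split=> /=.
- by rewrite o2 size_rcons.
- move=> i; rewrite size_rcons offsets_rcons o2 => ilt.
  case: leqP => [ile|ilt']; first by rewrite ltn_eqF // o4.
  by rewrite (_ : i = (size ll).+1) ?eqxx ?o3 ?size_cat //; lia.
- by rewrite o3 flatten_rcons cats0.
- by move=> i; rewrite flatten_rcons cats0; apply: o5.
Qed.

Lemma iota1_last k : 0 < k -> iota 1 k = iota 1 k.-1 ++ [:: k].
Proof. by case: k => // k _; rewrite -[k.+1]addn1 iotaD addn1. Qed.

(** On truth values, truncated subtraction of the negated second argument is conjunction. *)
Definition And x y := Defs.Sub x (Equal y (Const 0)).

Lemma eval_And s x y (a b : bool) :
  eval s x = a -> eval s y = b -> eval s (And x y) = (a && b).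
Proof. by move=> /= -> ->; case: a; case: b. Qed.

Definition end1 e := Cell 8 (Cell 6 e).
Definition end2 e := Cell 8 (Cell 7 e).

(* Indexed by edges: arrays 6 and 7 hold the ends, and array 12 is nonzero on
   tree edges.  Array 8 maps vertices to their preorder positions.  Indexed by
   the position of a nonroot vertex: arrays 10 and 11 hold the position of its
   parent and the edge to it, array 13 the end of its subtree, and array 14 the
   number of fundamental cycles through that edge. *)
Section Environment.
Variables (n m : nat) (P : nat -> nat * nat) (l te : nat -> nat) (nontree : pred nat).

Definition environment (s : state) :=
  [/\ reg s 0 = n, reg s 1 = m,
      forall e, e < m -> [/\ arr s 8 (arr s 6 e) = (P e).1,
        arr s 8 (arr s 7 e) = (P e).2 & (arr s 12 e == 0) = nontree e]
    & forall i, 0 < i < n -> arr s 13 i = l i /\ arr s 11 i = te i].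

Lemma environment_frame p s s' : frame p s s' ->
  ~~ has (fun r => r \in written_regs p) [:: 0; 1] ->
  ~~ has (fun a => a \in written_arrs p) [:: 6; 7; 8; 11; 12; 13] ->
  environment s -> environment s'.
Proof.
move=> [fr fa] /=; rewrite !negb_or => /and3P[r0 r1 _].
case/and5P=> a6 a7 a8 a11 /and3P[a12 a13 _] [e0 e1 ee ei].
split=> [||e elt|i i0]; rewrite ?fr //.
  by rewrite !fa //; apply: ee.
by rewrite !fa //; apply: ei.
Qed.

(** The difference of the two truth values is 1 only if [p < l i] holds and [p < i] fails. *)
Definition inside_expr i p := Defs.Sub (Less p (Cell 13 i)) (Less p i).
Definition crossing_expr i e :=
  Equal (Equal (inside_expr i (end1 e)) (inside_expr i (end2 e))) (Const 0).

Lemma eval_crossing s i e : environment s -> 0 < eval s i < n -> eval s e < m ->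
  eval s (crossing_expr i e) = crossing l (eval s i) (P (eval s e)).
Proof.
move=> [_ _ ee ei] i0 elt; have [Ei _] := ei _ i0; have [E1 E2 _] := ee _ elt.
rewrite /= E1 E2 Ei /crossing /inside.
have H p : (p < l (eval s i)) - (p < eval s i) = (eval s i <= p) && (p < l (eval s i)) :> nat.
  by rewrite [p < eval s i]ltnNge; case: (_ <= p); case: (p < _).
by rewrite !H; do 2 case: (_ && _).
Qed.

Definition emit_edges x :=
  for_loop 4 (Const 1) (Reg 0) (If x (push (Cell 11 (Reg 4))) Skip).

Lemma runs_emit x (C : pred nat) s ll c : environment s -> outputs s ll c ->
  (forall s', frame (emit_edges x) s s' -> 0 < reg s' 4 < n ->
     eval s' x = C (reg s' 4)) ->
  runs (emit_edges x) s (n * 5 + 2)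
    (fun s' => outputs s' ll (c ++ [seq te i | i <- iota 1 n.-1 & C i])).
Proof.
move=> env out xC.
pose I k s' := outputs s' ll (c ++ [seq te i | i <- iota 1 k.-1 & C i]).
apply: (runs_for (N := n) (b := 3) (I := I)) => //.
- by move=> s' fr; rewrite /= fr.1 //; case: env.
- by rewrite /I /= cats0; apply: outputs_eq out.
- move=> k s' /= kn fr r4 Ik; have k0 : 0 < k < n by lia.
  have envs' := environment_frame fr isT isT env.
  apply: runs_loop_free => //=; rewrite xC ?r4 //.
  rewrite eqb0 negbK /I iota1_last; last by case/andP: k0.
  rewrite filter_cat map_cat catA /=; case: (C k) => /=; last by rewrite cats0; apply: outputs_eq Ik.
  have := outputs_push (Cell 11 (Reg 4)) Ik; rewrite /= r4.
  have [_ _ _ /(_ k k0)[_ ->]] := envs'; rewrite cats1.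
  exact: outputs_eq.
- move=> s' fr /=; rewrite /I; case: (posnP n) => [->|n0]; first by [].
  by rewrite (_ : maxn 1 n = n) //; lia.
Qed.
End Environment.

(** A weakest precondition for code without loops; [While] falls into the default clause and is
    excluded by [loop_free] in [runs_wp]. *)
Fixpoint wp p (Q : state -> Prop) s : Prop :=
  match p with
  | SetReg r x => Q (set_reg s r (eval s x))
  | SetCell a i x => Q (set_cell s a (eval s i) (eval s x))
  | Seq p q => wp p (wp q Q) s
  | If x p q => (eval s x != 0 -> wp p Q s) /\ (eval s x == 0 -> wp q Q s)
  | _ => Q s
  end.

Lemma runs_wp p s b (Q : state -> Prop) :
  loop_free p -> cost p <= b -> wp p Q s -> runs p s b Q.
Proof.
move=> lf cb H; apply: runs_loop_free => //.
elim: p Q s H {lf cb} => //= [p IHp q IHq Q s|x p IHp q IHq Q s [Hp Hq]].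
  by move/IHp/IHq.
by case: (boolP (eval s x != 0)) => [/Hp/IHp|/negPn/Hq/IHq].
Qed.

Definition emit_fundamental :=
  for_loop 5 (Const 0) (Reg 1) (If (Cell 12 (Reg 5)) Skip
    (Seq (push (Reg 5))
    (Seq (emit_edges (crossing_expr (Reg 4) (Reg 5))) close_list))).

Section Fundamental.
Variables (n m : nat) (P : nat -> nat * nat) (l te : nat -> nat) (nontree : pred nat).
Local Notation environment := (environment n m P l te nontree).

Definition fundamental_list e :=
  e :: [seq te i | i <- iota 1 n.-1 & crossing l i (P e)].

Lemma runs_fundamental s : environment s -> outputs s [::] [::] ->
  runs emit_fundamental s (m * (n * 5 + 9) + 2) (fun s' =>
    outputs s' [seq fundamental_list e | e <- iota 0 m & nontree e] [::]).
Proof.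
move=> env out.
pose I k s' := outputs s' [seq fundamental_list e | e <- iota 0 k & nontree e] [::].
apply: (@runs_weaken _ _ (m * (n * 5 + 7 + 2) + 2)) => //; last first.
- by move=> s' _; apply.
- by rewrite -addnA.
apply: (runs_for (N := m) (I := I)) => //.
- by move=> s' fr; rewrite /= fr.1 //; case: env.
- move=> k s' /= km fr r5 Ik; have env' := environment_frame fr isT isT env.
  have [_ _ /(_ k km)[_ _ ntk] _] := env'.
  have -> : n * 5 + 7 = (2 + (n * 5 + 2 + 2)).+1 by lia.
  rewrite /I -[k.+1]addn1 iotaD filter_cat map_cat add0n /=.
  apply: runs_if => /= H12; rewrite r5 in H12.
    apply: runs_wp => //=; rewrite -ntk (negbTE H12) cats0.
    exact: outputs_eq Ik.
  rewrite -ntk H12 /= cats1.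
  apply: (@runs_seq _ _ _ _ _ (fun s1 => outputs s1
    [seq fundamental_list e | e <- iota 0 k & nontree e] [:: k])).
    by apply: runs_wp => //=; have := outputs_push (Reg 5) Ik; rewrite /= r5.
  move=> s1 fr1 out1; have env1 := environment_frame fr1 isT isT env'.
  have r51 : reg s1 5 = k by rewrite fr1.1.
  apply: runs_seq.
    apply: (runs_emit (C := fun i => crossing l i (P k)) env1 out1) => s2 fr2 r42.
    have env2 := environment_frame fr2 isT isT env1.
    have r52 : reg s2 5 = k by rewrite fr2.1.
    by rewrite (eval_crossing env2) /= ?r52.
  move=> s2 fr2 out2; apply: runs_wp => //=.
  exact: outputs_eq (outputs_close out2).
- by move=> s' _; rewrite /= max0n.
Qed.
End Fundamental.

(** * Extreme edges and the pair for one tree edge *)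

Section SemiFundamental.
Variables (n m : nat) (P : nat -> nat * nat) (l te : nat -> nat) (nontree : pred nat).
Local Notation environment := (environment n m P l te nontree).
Local Notation covers := (in_cover l P nontree).

(* While N is empty, the values n.+1 and 0 make its first element take both
   places; ties make e2 the later edge, so that e1 = e2 only for singletons. *)
Definition track (h : nat -> nat) (N : seq nat) e1 e2 v1 v2 :=
  if nilp N then v1 = n.+1 /\ v2 = 0 else
  [/\ e1 \in N /\ e2 \in N, v1 = h e1 /\ v2 = h e2,
      {in N, forall e, v1 <= h e <= v2} & e1 = e2 -> size N = 1].

Lemma track_rcons h N e1 e2 v1 v2 k : h k <= n -> k \notin N ->
  track h N e1 e2 v1 v2 ->
  track h (rcons N k) (if h k < v1 then k else e1) (if h k < v2 then e2 else k)
    (if h k < v1 then h k else v1) (if h k < v2 then v2 else h k).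
Proof.
move=> hn kN; rewrite /track [nilp (rcons N k)]/nilp size_rcons /=.
case: nilP kN => [-> _ [-> ->]|_ kN [[e1N e2N] [-> ->] bd ne]].
  rewrite ltnS hn; split; rewrite ?inE ?eqxx //.
  by move=> e; rewrite inE => /eqP ->; rewrite !leqnn.
have := bd _ e1N => bde1.
split; rewrite ?mem_rcons.
- by split; case: ifP => _; rewrite inE ?eqxx ?e1N ?e2N ?orbT.
- by split; case: ifP.
- move=> e; rewrite mem_rcons inE => /predU1P[->|/bd]; case: (ltnP (h k) (h e1)); case: (ltnP (h k) (h e2)); lia.
- case: ltnP => l1; case: ltnP => l2 E.
  + by rewrite E e2N in kN.
  + lia.
  + by rewrite E in l1; lia.
  + by rewrite -E e1N in kN.
Qed.

Definition set_key r p := If (Less p (Reg 6)) (SetReg r (Defs.Sub (Reg 6) p))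
  (SetReg r (Defs.Sub (Reg 0) (Defs.Sub p (Reg 6)))).

Definition set_keys :=
  Seq (set_key 18 (end1 (Reg 5))) (Seq (set_key 19 (end2 (Reg 5)))
    (If (Less (Reg 18) (Reg 19)) (Seq (SetReg 12 (Reg 19)) (SetReg 13 (Reg 18)))
      (Seq (SetReg 12 (Reg 18)) (SetReg 13 (Reg 19))))).

(** With the position of the tree edge t in register 6, the current edge in register 5 and its keys
    in 12 and 13, registers 8 to 11 hold the four extreme edges, 14 to 17 their keys, and 7 the
    number of edges of N t met so far. *)
Definition update_extremes :=
  Seq (If (Less (Reg 12) (Reg 14)) (Seq (SetReg 8 (Reg 5)) (SetReg 14 (Reg 12))) Skip)
  (Seq (If (Less (Reg 12) (Reg 15)) Skip (Seq (SetReg 9 (Reg 5)) (SetReg 15 (Reg 12))))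
  (Seq (If (Less (Reg 13) (Reg 16)) (Seq (SetReg 10 (Reg 5)) (SetReg 16 (Reg 13))) Skip)
  (Seq (If (Less (Reg 13) (Reg 17)) Skip (Seq (SetReg 11 (Reg 5)) (SetReg 17 (Reg 13))))
    (SetReg 7 (Succ (Reg 7)))))).

Definition find_extremes :=
  Seq (Seq (SetReg 7 (Const 0))
    (Seq (Seq (SetReg 14 (Succ (Reg 0))) (SetReg 15 (Const 0)))
         (Seq (SetReg 16 (Succ (Reg 0))) (SetReg 17 (Const 0)))))
  (for_loop 5 (Const 0) (Reg 1) (If (Cell 12 (Reg 5)) Skip
    (If (crossing_expr (Reg 6) (Reg 5)) (Seq set_keys update_extremes) Skip))).

Hypothesis P_lt : forall e, nontree e -> (P e).1 < n /\ (P e).2 < n.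

Definition covering_list t := [seq e <- iota 0 m | covers t e].

Lemma runs_set_keys s t e : environment s -> reg s 6 = t -> reg s 5 = e -> e < m ->
  runs set_keys s 7 (fun s' => reg s' 12 = high_key n t (P e) /\
                               reg s' 13 = low_key n t (P e)).
Proof.
move=> [e0 _ ee _] r6 r5 /ee[E1 E2 _]; apply: runs_wp => //=.
rewrite r5 E1 E2 r6 e0 /high_key /low_key /cyclic_key.
split=> H1; (split=> H2; (split=> H3; split; move: H1 H2 H3));
  rewrite ?eqb0 ?negbK => ? ? ?; do 2 case: ifP => ?; lia.
Qed.

Lemma runs_find_extremes s t : environment s -> reg s 6 = t -> 0 < t < n ->
  runs find_extremes s (m * 24 + 7) (fun s' =>
    [/\ reg s' 7 = size (covering_list t),
      track (fun e => high_key n t (P e)) (covering_list t)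
        (reg s' 8) (reg s' 9) (reg s' 14) (reg s' 15)
    & track (fun e => low_key n t (P e)) (covering_list t)
        (reg s' 10) (reg s' 11) (reg s' 16) (reg s' 17)]).
Proof.
(* The initialisation takes 5 steps. An iteration takes 22: two tests, 7 for the keys and 13 for the
   updates. *)
move=> env r6 t0; have -> : m * 24 + 7 = 5 + (m * (22 + 2) + 2) by lia.
pose N k := [seq e <- iota 0 k | covers t e].
pose I k s' :=
    [/\ reg s' 7 = size (N k),
      track (fun e => high_key n t (P e)) (N k)
        (reg s' 8) (reg s' 9) (reg s' 14) (reg s' 15)
    & track (fun e => low_key n t (P e)) (N k)
        (reg s' 10) (reg s' 11) (reg s' 16) (reg s' 17)].
apply: (@runs_seq _ _ _ _ _ (I 0)).
  by apply: runs_wp => //=; rewrite /I /track /=; have [-> _ _ _] := env.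
move=> s0 fr0 I0; have env0 := environment_frame fr0 isT isT env.
have r60 : reg s0 6 = t by rewrite fr0.1.
apply: (runs_for (N := m) (I := I)) => //.
- by move=> s' fr; rewrite /= fr.1 //; case: env0.
- move=> k s' /= km fr r5 Ik; have env' := environment_frame fr isT isT env0.
  have r6' : reg s' 6 = t by rewrite fr.1.
  have [_ _ /(_ k km)[_ _ ntk] _] := env'.
  have NS : N k.+1 = if covers t k then rcons (N k) k else N k.
    by rewrite /N -[k.+1]addn1 iotaD filter_cat add0n /=; case: ifP; rewrite ?cats1 ?cats0.
  have skip : ~~ covers t k -> I k.+1 (set_reg s' 5 k.+1).
    by move=> /negbTE ct; rewrite /I NS ct.
  rewrite -[22]/(21.+1); apply: runs_if => H12.
    apply: runs_wp => //=; apply: skip; apply/negP => /andP[].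
    by rewrite -ntk -{1}r5 (negbTE H12).
  rewrite -[21]/(20.+1); apply: runs_if => Hc.
    have ct : covers t k.
      move: Hc; rewrite (eval_crossing env') /= ?r6' ?r5 // eqb0 negbK => ct.
      by rewrite /in_cover ct -ntk -{1}r5 /= andbT; apply/eqP.
    have [Pk1 Pk2] : (P k).1 < n /\ (P k).2 < n by have /andP[/P_lt] := ct.
    rewrite -[20]/(7 + 13); apply: runs_seq (runs_set_keys env' r6' r5 km) _.
    move=> s1 fr1 [r12 r13]; case: Ik => I7 Ih Il.
    have kN : k \notin N k by rewrite mem_filter mem_iota /= ltnn andbF.
    have hn : high_key n t (P k) <= n by rewrite /high_key /cyclic_key; do 2 case: ifP; lia.
    have ln : low_key n t (P k) <= n by rewrite /low_key /cyclic_key; do 2 case: ifP; lia.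
    have /= := @track_rcons (fun e => high_key n t (P e)) _ _ _ _ _ k hn kN Ih.
    have /= := @track_rcons (fun e => low_key n t (P e)) _ _ _ _ _ k ln kN Il.
    have rr r : r \notin [:: 12; 13; 18; 19] -> reg s1 r = reg s' r.
      move=> nr; apply: fr1.1; apply: contra nr.
      exact: (allP (isT : all (mem [:: 12; 13; 18; 19]) (written_regs set_keys))).
    move=> Tl Th; apply: runs_wp => //=; rewrite /I /= r12 r13 !rr // NS ct size_rcons -I7 r5.
    split=> H1; (split=> H2; (split=> H3; (split=> H4)));
      move: H1 H2 H3 H4 Tl Th; rewrite ?eqb0 ?negbK; do 4 case: (_ < _) => //=.
  apply: runs_wp => //=; apply: skip; apply/negP => /andP[_ ct].
  by move: Hc; rewrite (eval_crossing env') /= ?r6' ?r5 // ct.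
- by move=> s' _; rewrite /= max0n.
Qed.
End SemiFundamental.

Lemma eval_Not s x (a : bool) :
  eval s x = a -> eval s (Equal x (Const 0)) = ~~ a.
Proof. by move=> /= ->; rewrite eqb0. Qed.

Lemma eval_Xor s x y (a b : bool) :
  eval s x = a -> eval s y = b -> eval s (Equal (Equal x y) (Const 0)) = a (+) b.
Proof. by move=> /= -> ->; case: a; case: b. Qed.

(** Registers 12 and 13 record the two [apart] tests of [merge_pair], gathered in one pass over the
    tree edges. *)
Definition merge_into g :=
  Seq (Seq (SetReg 12 (Const 0)) (SetReg 13 (Const 0)))
  (Seq (for_loop 4 (Const 1) (Reg 0)
    (Seq (If (And (crossing_expr (Reg 4) (Reg 8)) (And (crossing_expr (Reg 4) (Reg 9))
                 (Equal (crossing_expr (Reg 4) g) (Const 0))))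
            (SetReg 12 (Const 1)) Skip)
         (If (And (crossing_expr (Reg 4) g) (And (crossing_expr (Reg 4) (Reg 8))
                 (Equal (crossing_expr (Reg 4) (Reg 9)) (Const 0))))
            (SetReg 13 (Const 1)) Skip)))
    (If (Reg 12) (If (Reg 13) (SetReg 8 g) (SetReg 9 g)) Skip)).

Definition check_repeated :=
  Seq (SetReg 12 (Const 0))
    (for_loop 4 (Const 1) (Reg 6)
      (If (And (crossing_expr (Reg 4) (Reg 8)) (And (crossing_expr (Reg 4) (Reg 9))
               (Equal (Cell 14 (Reg 4)) (Reg 7))))
         (SetReg 12 (Const 1)) Skip)).

Definition emit_pair :=
  Seq (Seq (push (Reg 8)) (push (Reg 9)))
    (Seq (emit_edges (Equal (Equal (crossing_expr (Reg 4) (Reg 8))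
                                   (crossing_expr (Reg 4) (Reg 9))) (Const 0)))
         close_list).

Definition process_edge :=
  Seq find_extremes (Seq (SetCell 14 (Reg 6) (Reg 7))
    (If (Less (Const 1) (Reg 7))
      (Seq (merge_into (Reg 10)) (Seq (merge_into (Reg 11)) (Seq check_repeated
        (If (Reg 12) Skip emit_pair))))
      Skip)).

Definition emit_semi_fundamental := for_loop 6 (Const 1) (Reg 0) process_edge.

Section SemiFundamental.
Variables (n m : nat) (P : nat -> nat * nat) (l te : nat -> nat) (nontree : pred nat).
Local Notation environment := (environment n m P l te nontree).
Local Notation covers := (in_cover l P nontree).
Local Notation covering_list := (covering_list m P l nontree).
Local Notation tight_pair := (tight_pair n l P nontree).
Local Notation cr s e := (crossing l s (P e)).

Lemma runs_merge rg s x y g : environment s ->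
  reg s 8 = x -> reg s 9 = y -> reg s rg = g -> x < m -> y < m -> g < m ->
  rg \notin written_regs (merge_into (Reg rg)) ->
  runs (merge_into (Reg rg)) s (n * 8 + 7) (fun s' =>
    (reg s' 8, reg s' 9) = merge_pair n l P g (x, y)).
Proof.
move=> env r8 r9 rrg xm ym gm nw.
have -> : n * 8 + 7 = 2 + ((n * (6 + 2) + 2) + 3) by lia.
pose A k := has (fun s => [&& cr s x, cr s y & ~~ cr s g]) (iota 1 k.-1).
pose B k := has (fun s => [&& cr s g, cr s x & ~~ cr s y]) (iota 1 k.-1).
pose I k s' := reg s' 12 = A k /\ reg s' 13 = B k.
apply: (@runs_seq _ _ _ _ _ (I 1)); first exact: runs_wp.
move=> s0 fr0 I0; have env0 := environment_frame fr0 isT isT env.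
have nw' r : r \in [:: 4; 8; 9; 12; 13] -> rg != r.
  move=> rin; apply: contraNneq nw => E; rewrite {1}E; move: rin.
  exact: (allP (isT : all (mem (written_regs (merge_into (Reg rg)))) [:: 4; 8; 9; 12; 13])).
have r80 : reg s0 8 = x by rewrite fr0.1.
have r90 : reg s0 9 = y by rewrite fr0.1.
have rg0 : reg s0 rg = g by rewrite fr0.1 //= !inE !negb_or !nw'.
apply: (@runs_seq _ _ _ _ _ (I n)).
  apply: (runs_for (N := n) (I := I)) => //.
  - by move=> s' fr; rewrite /= fr.1 //; case: env0.
  - move=> k s' kn fr r4 [IA IB]; have env' := environment_frame fr isT isT env0.
    have k0 : 0 < k < n by move: kn => /=; lia.
    have r8' : reg s' 8 = x by rewrite fr.1.
    have r9' : reg s' 9 = y by rewrite fr.1.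
    have rg' : reg s' rg = g by rewrite fr.1 //= !inE !negb_or !nw'.
    have S s2 e j : environment s2 -> reg s2 4 = k -> reg s2 j = e -> e < m ->
        eval s2 (crossing_expr (Reg 4) (Reg j)) = cr k e.
      by move=> env2 r42 r2 em; rewrite (eval_crossing env2) /= ?r42 ?r2.
    have T s2 e j : environment s2 -> reg s2 4 = k -> reg s2 j = e -> e < m ->
        eval s2 (Equal (crossing_expr (Reg 4) (Reg j)) (Const 0)) = ~~ cr k e.
      by move=> env2 r42 r2 em; apply/eval_Not/S.
    have iotak : iota 1 k = iota 1 k.-1 ++ [:: k] by rewrite iota1_last //; case/andP: k0.
    rewrite -[6]/(3 + 3).
    apply: (@runs_seq _ _ _ _ _ (fun s2 => reg s2 12 = A k.+1 /\ reg s2 13 = B k)).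
      rewrite /A /= iotak has_cat /= orbF -/(A k).
      apply: (@runs_weaken _ _ 2) => //; last by move=> s2 _; apply.
      apply: runs_if;
        rewrite (eval_And (S _ x _ env' r4 r8' xm) (eval_And (S _ y _ env' r4 r9' ym) (T _ g _ env' r4 rg' gm))).
        by rewrite eqb0 negbK => ->; apply: runs_wp => //=; rewrite orbT.
      by move/eqP; rewrite eqb0 => /negbTE ->; apply: runs_wp => //=; rewrite orbF.
    move=> s2 fr2 [A2 B2]; have env2 := environment_frame fr2 isT isT env'.
    have r42 : reg s2 4 = k by rewrite fr2.1.
    have r82 : reg s2 8 = x by rewrite fr2.1.
    have r92 : reg s2 9 = y by rewrite fr2.1.
    have rg2 : reg s2 rg = g by rewrite fr2.1 //= !inE nw'.
    rewrite /I /B /= iotak has_cat /= orbF -/(B k).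
    apply: (@runs_weaken _ _ 2) => //; last by move=> s3 _; apply.
    apply: runs_if;
      rewrite (eval_And (S _ g _ env2 r42 rg2 gm) (eval_And (S _ x _ env2 r42 r82 xm) (T _ y _ env2 r42 r92 ym))).
      by rewrite eqb0 negbK => ->; apply: runs_wp => //=; rewrite orbT.
    by move/eqP; rewrite eqb0 => /negbTE ->; apply: runs_wp => //=; rewrite orbF.
  - move=> s' _ /=; rewrite /I /A /B; case: (posnP n) => [->|n0]; first by [].
    by rewrite (_ : maxn 1 n = n) //; lia.
move=> s1 fr1 [A1 B1].
have r81 : reg s1 8 = x by rewrite fr1.1.
have r91 : reg s1 9 = y by rewrite fr1.1.
have rg1 : reg s1 rg = g by rewrite fr1.1 //= !inE !negb_or !nw'.
apply: runs_wp => //=; rewrite A1 B1 rg1 r81 r91 /merge_pair /apart /= -/(A n) -/(B n).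
by case: (A n); case: (B n).
Qed.

Lemma runs_check s t x y c : environment s ->
  reg s 6 = t -> 0 < t < n -> reg s 7 = c -> reg s 8 = x -> reg s 9 = y ->
  x < m -> y < m ->
  runs check_repeated s (n * 5 + 3) (fun s' => reg s' 12 =
    has (fun i => [&& cr i x, cr i y & arr s 14 i == c]) (iota 1 t.-1)).
Proof.
move=> env r6 t0 r7 r8 r9 xm ym.
apply: (@runs_weaken _ _ (1 + (t * (2 + 2) + 2))) => //; last first.
- by move=> s' _; apply.
- by lia.
pose I k s' := reg s' 12 =
    has (fun i => [&& cr i x, cr i y & arr s 14 i == c]) (iota 1 k.-1) :> nat.
apply: (@runs_seq _ _ _ _ _ (I 1)); first exact: runs_wp.
move=> s0 fr0 I0; have env0 := environment_frame fr0 isT isT env.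
apply: (runs_for (N := t) (I := I)) => //.
- by move=> s' fr; rewrite /= fr.1 // fr0.1.
- move=> k s' kt fr r4 Ik; have env' := environment_frame fr isT isT env0.
  have k0 : 0 < k < n by move: kt => /=; lia.
  have R r : r \in [:: 6; 7; 8; 9] -> reg s' r = reg s r.
    by rewrite !inE => /or4P[] /eqP ->; rewrite fr.1 // fr0.1.
  have S e j : reg s' j = e -> e < m ->
      eval s' (crossing_expr (Reg 4) (Reg j)) = cr k e.
    by move=> r2 em; rewrite (eval_crossing env') /= ?r4 ?r2.
  have E : eval s' (Equal (Cell 14 (Reg 4)) (Reg 7)) = (arr s 14 k == c).
    by rewrite /= r4 fr.2 // fr0.2 // R // r7.
  rewrite /I /= iota1_last ?has_cat /= ?orbF; last by case/andP: k0.
  rewrite -/(I k s'); apply: runs_if;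
    rewrite (eval_And (S x 8 _ _) (eval_And (S y 9 _ _) E)) ?R //.
    by rewrite eqb0 negbK => ->; apply: runs_wp => //=; rewrite orbT.
  by move/eqP; rewrite eqb0 => /negbTE ->; apply: runs_wp => //=; rewrite orbF.
- by move=> s' _ /=; rewrite (_ : maxn 1 t = t) //; lia.
Qed.

Definition pair_list x y := x :: y :: [seq te i | i <- iota 1 n.-1 & cr i x (+) cr i y].

Lemma runs_emit_pair s ll x y : environment s -> outputs s ll [::] ->
  reg s 8 = x -> reg s 9 = y -> x < m -> y < m ->
  runs emit_pair s (n * 5 + 8) (fun s' => outputs s' (rcons ll (pair_list x y)) [::]).
Proof.
move=> env out r8 r9 xm ym.
have -> : n * 5 + 8 = 4 + ((n * 5 + 2) + 2) by lia.
apply: (@runs_seq _ _ _ _ _ (fun s1 => outputs s1 ll [:: x; y])).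
  apply: runs_loop_free => //.
  have := outputs_push (Reg 9) (outputs_push (Reg 8) out).
  by rewrite [eval _ (Reg 9)]/= [eval _ (Reg 8)]/= r8 r9.
move=> s1 fr1 out1; have env1 := environment_frame fr1 isT isT env.
apply: runs_seq.
  apply: (runs_emit (C := fun i => cr i x (+) cr i y) env1 out1) => s2 fr2 r42.
  have env2 := environment_frame fr2 isT isT env1.
  have S e j : reg s2 j = e -> e < m ->
      eval s2 (crossing_expr (Reg 4) (Reg j)) = cr (reg s2 4) e.
    by move=> r2 em; rewrite (eval_crossing env2) /= ?r2.
  have r82 : reg s2 8 = x by rewrite fr2.1 // fr1.1.
  have r92 : reg s2 9 = y by rewrite fr2.1 // fr1.1.
  exact: eval_Xor (S _ _ r82 xm) (S _ _ r92 ym).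
move=> s2 fr2 out2; apply: runs_loop_free => //.
exact: outputs_close out2.
Qed.
End SemiFundamental.

Section Selection.
Variables (n m : nat) (P : nat -> nat * nat) (l te : nat -> nat) (nontree : pred nat).
Local Notation environment := (environment n m P l te nontree).
Local Notation covers := (in_cover l P nontree).
Local Notation covering_list := (covering_list m P l nontree).
Local Notation tight_pair := (tight_pair n l P nontree).
Local Notation pair_list := (pair_list n P l te).

Hypothesis nontree_lt : forall e, nontree e -> e < m.
Hypothesis P_lt : forall e, nontree e -> (P e).1 < n /\ (P e).2 < n.
Hypothesis lam : laminar n l.

Lemma mem_covering_list t e : (e \in covering_list t) = covers t e.
Proof.
rewrite mem_filter mem_iota add0n; case H: (covers t e) => //=.
by have /andP[/nontree_lt] := H.
Qed.

Definition repeated t :=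
  has (fun s => covering_list s == covering_list t) (iota 1 t.-1).
Definition chosen t := (1 < size (covering_list t)) && ~~ repeated t.

(** Both paths of a tight pair contain s exactly if the covering set of [t] is contained in that of
    s, so equality is decided by comparing sizes. With the sizes stored, each earlier edge is
    checked in constant time. *)
Lemma repeatedE t x y : 0 < t < n -> tight_pair t x y ->
  repeated t = has (fun s => [&& crossing l s (P x), crossing l s (P y)
    & size (covering_list s) == size (covering_list t)]) (iota 1 t.-1).
Proof.
move=> t0 [tx ty xy tight]; apply: eq_in_has => s; rewrite mem_iota => si.
apply/eqP/and3P => [st|[sx sy /eqP sz]].
  by move: tx ty; rewrite -!mem_covering_list -st eqxx !mem_covering_list;
    move=> /andP[_ ->] /andP[_ ->].
have sub : {subset covering_list t <= covering_list s}.
  move=> e; rewrite !mem_covering_list => te'; have /andP[nt _] := te'.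
  by rewrite /in_cover nt (tight s) //; lia.
have [] := uniq_min_size (filter_uniq _ (iota_uniq 0 m)) sub; first by rewrite sz.
move=> _ eqi; apply: eq_in_filter => e _.
by rewrite -!mem_covering_list eqi.
Qed.

Lemma track_extremes t e1 e2 v1 v2 f1 f2 w1 w2 :
  1 < size (covering_list t) ->
  track n (fun e => high_key n t (P e)) (covering_list t) e1 e2 v1 v2 ->
  track n (fun e => low_key n t (P e)) (covering_list t) f1 f2 w1 w2 ->
  extreme_edges n l P nontree t e1 e2 f1 f2 /\ e1 != e2.
Proof.
move=> N2; rewrite /track /nilp gtn_eqF 1?ltnW //.
move=> [[e1N e2N] [-> ->] bd ne] [[f1N f2N] [-> ->] bd' _].
split; last by apply: contraTneq N2 => /ne ->.
split; rewrite -?mem_covering_list // => e; rewrite -mem_covering_list => eN.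
by have /andP[-> ->] := bd e eN; have /andP[-> ->] := bd' e eN.
Qed.

(** The size of the covering set is stored in array 14 even if no cycle is emitted, since later tree
    edges are compared with it. *)
Lemma runs_process_edge s t ll : environment s -> reg s 6 = t -> 0 < t < n ->
  outputs s ll [::] -> (forall i, 0 < i < t -> arr s 14 i = size (covering_list i)) ->
  runs process_edge s (m * 24 + n * 26 + 40) (fun s' =>
    (forall i, 0 < i < t.+1 -> arr s' 14 i = size (covering_list i)) /\
    if chosen t then
      exists x y, tight_pair t x y /\ outputs s' (rcons ll (pair_list x y)) [::]
    else outputs s' ll [::]).
Proof.
move=> env r6 t0 out cnt.
apply: (@runs_weaken _ _ ((m * 24 + 7) + (1 + ((n * 8 + 7) + ((n * 8 + 7) +
  ((n * 5 + 3) + (n * 5 + 8).+1))).+1))) => //; last first.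
- by move=> s' _; apply.
- by lia.
apply: (runs_seq (runs_find_extremes P_lt env r6 t0)).
move=> s1 fr1 [r7 Th Tl]; have env1 := environment_frame fr1 isT isT env.
have out1 := outputs_frame fr1 isT isT isT isT out.
have r61 : reg s1 6 = t by rewrite fr1.1.
pose cnt_upto k s' := forall i, 0 < i < k -> arr s' 14 i = size (covering_list i).
apply: (@runs_seq _ _ _ _ _ (fun s2 => cnt_upto t.+1 s2 /\
  forall r, reg s2 r = reg s1 r)).
  apply: runs_loop_free => //; split=> // i it /=; rewrite r61.
  case: eqP => [->|it'] /=; first by rewrite r7.
  by rewrite fr1.2 //; apply: cnt; lia.
move=> s2 fr2 [cnt2 r12]; have env2 := environment_frame fr2 isT isT env1.
have out2 := outputs_frame fr2 isT isT isT isT out1.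
apply: runs_if; rewrite /= r12 r7; last first.
  move/eqP; rewrite eqb0 => N1; apply: runs_wp => //; first by rewrite /=; lia.
  by rewrite /chosen (negbTE N1).
rewrite eqb0 negbK => N2; have [ext ne] := track_extremes N2 Th Tl.
have [c1 c2 c3 c4 _] := ext.
have lt e : covers t e -> e < m by case/andP=> /nontree_lt.
apply: runs_seq.
  by apply: (runs_merge (rg := 10) env2); rewrite ?r12 //; apply: lt.
move=> s3 fr3 m3; have env3 := environment_frame fr3 isT isT env2.
have out3 := outputs_frame fr3 isT isT isT isT out2.
have [c31 c32 ne3 _] := merge_pairP lam t0 c3 (xy := (_, _)) c1 c2 ne.
rewrite /= in m3; rewrite -m3 /= in c31 c32 ne3.
apply: runs_seq.
  apply: (runs_merge (rg := 11) (g := reg s1 11) env3) => //.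
  - by rewrite fr3.1 // r12.
  - exact: lt c31.
  - exact: lt c32.
  - exact: lt c4.
move=> s4 fr4 m4; have env4 := environment_frame fr4 isT isT env3.
have out4 := outputs_frame fr4 isT isT isT isT out3.
have tight : tight_pair t (reg s4 8) (reg s4 9).
  have := merge_extremes lam P_lt t0 ext ne.
  by rewrite -m3 -m4.
have r64 : reg s4 6 = t by rewrite fr4.1 // fr3.1 // r12.
have r74 : reg s4 7 = size (covering_list t) by rewrite fr4.1 // fr3.1 // r12.
have [ct1 ct2 _ _] := tight.
apply: runs_seq.
  exact: (runs_check env4 r64 t0 r74 erefl erefl (lt _ ct1) (lt _ ct2)).
move=> s5 fr5; have env5 := environment_frame fr5 isT isT env4.
have out5 := outputs_frame fr5 isT isT isT isT out4.
have cnt4 i : 0 < i < t.+1 -> arr s4 14 i = size (covering_list i).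
  by move=> it; rewrite fr4.2 // fr3.2 //; apply: cnt2.
have -> : has (fun i => [&& crossing l i (P (reg s4 8)), crossing l i (P (reg s4 9))
    & arr s4 14 i == size (covering_list t)]) (iota 1 t.-1) = repeated t.
  rewrite (repeatedE t0 tight); apply: eq_in_has => i; rewrite mem_iota => it.
  by rewrite cnt4 //; lia.
move=> r125.
have cnt5 : cnt_upto t.+1 s5 by move=> i it; rewrite fr5.2 //; apply: cnt4.
apply: runs_if; rewrite /= r125; last move/eqP.
  rewrite eqb0 negbK => rep; apply: runs_wp => //; first by rewrite /=; lia.
  by rewrite /chosen rep andbF.
rewrite eqb0 => nrep; have -> : chosen t by rewrite /chosen N2.
have r85 : reg s5 8 = reg s4 8 by rewrite fr5.1.
have r95 : reg s5 9 = reg s4 9 by rewrite fr5.1.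
apply: (runs_weaken (runs_emit_pair env5 out5 r85 r95 (lt _ ct1) (lt _ ct2))) => //.
move=> s6 fr6 out6; split; last by exists (reg s4 8), (reg s4 9).
by move=> i it; rewrite fr6.2 //; apply: cnt5.
Qed.

Lemma runs_semi_fundamental s ll : environment s -> outputs s ll [::] -> 
  runs emit_semi_fundamental s (n * (m * 24 + n * 26 + 42) + 2) (fun s' =>
    exists X Y : nat -> nat,
      {in iota 1 n.-1, forall t, chosen t -> tight_pair t (X t) (Y t)} /\
      outputs s' (ll ++ [seq pair_list (X t) (Y t) | t <- iota 1 n.-1 & chosen t]) [::]).
Proof.
move=> env out.
pose I k s' := (forall i, 0 < i < k -> arr s' 14 i = size (covering_list i)) /\
    exists X Y : nat -> nat,
      {in iota 1 k.-1, forall t, chosen t -> tight_pair t (X t) (Y t)} /\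
      outputs s' (ll ++ [seq pair_list (X t) (Y t) | t <- iota 1 k.-1 & chosen t]) [::].
apply: (@runs_weaken _ _ (n * (m * 24 + n * 26 + 40 + 2) + 2)) => //; last first.
- by move=> s' _; apply.
- by rewrite -addnA.
apply: (runs_for (N := n) (I := I)) => //.
- by move=> s' fr; rewrite /= fr.1 //; case: env.
- split=> [i|]; first by rewrite /=; lia.
  by exists id, id; split=> //; rewrite /= cats0; apply: outputs_eq out.
- move=> k s' kn fr r6 [cnt [X [Y [XY out']]]].
  have k0 : 0 < k < n by move: kn => /=; lia.
  have env' := environment_frame fr isT isT env.
  apply: (runs_weaken (runs_process_edge env' r6 k0 out' cnt)) => // s1 fr1 [cnt1 H].
  split=> //; rewrite /= iota1_last; last by case/andP: k0.
  case: ifP H => ck.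
    move=> [x [y [xy out1]]].
    (* The pair for [k] is known only from the run, so the two functions are extended at [k] as the
       loop proceeds. *)
    exists (fun t => if t == k then x else X t), (fun t => if t == k then y else Y t).
    split=> [t|].
      rewrite mem_cat mem_seq1 => /orP[ti|/eqP ->]; last by rewrite eqxx.
      rewrite ltn_eqF; first exact: XY.
      by move: ti; rewrite mem_iota; lia.
    rewrite filter_cat /= ck map_cat /= eqxx catA cats1.
    rewrite (_ : [seq _ | t <- [seq t <- iota 1 k.-1 | chosen t]] =
      [seq pair_list (X t) (Y t) | t <- iota 1 k.-1 & chosen t]).
      exact: outputs_eq out1.
    apply/eq_in_map => t; rewrite mem_filter mem_iota => ti.
    by rewrite ltn_eqF //; lia.
  move=> out1; exists X, Y; split=> [t|].
    rewrite mem_cat mem_seq1 => /orP[ti|/eqP ->]; first exact: XY.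
    by rewrite ck.
  by rewrite filter_cat /= ck cats0; apply: outputs_eq out1.
- move=> s' _ [_ [X [Y [XY out']]]]; exists X, Y.
  move: XY out'; rewrite /=; case: (posnP n) => [->|n0]; first by [].
  by rewrite (_ : maxn 1 n = n) //; lia.
Qed.
End Selection.

(** * Reading the graph, searching it and delimiting subtrees *)

Definition read_ends :=
  Seq (SetReg 5 (Const 0))
    (for_loop 4 (Const 0) (Reg 0)
      (for_loop 5 (Reg 5) (Cell 0 (Succ (Reg 4)))
        (Seq (SetCell 6 (Cell 1 (Reg 5)) (Reg 4))
             (SetCell 7 (Cell 1 (Reg 5)) (Cell 2 (Reg 5)))))).

(** An edge may occur in several entries, a later one overwriting the earlier; this is harmless
    because every entry satisfies [is_ends]. Register 5 runs on through the rows, yet each row is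
    charged the full length [offs n], which is coarse but of order mn. *)
Lemma runs_read_ends s n (offs : nat -> nat) (is_ends : nat -> nat -> nat -> Prop) :
  reg s 0 = n -> (forall i, i <= n -> arr s 0 i = offs i) -> offs 0 = 0 ->
  (forall v, v < n -> offs v <= offs v.+1 <= offs n) ->
  (forall v q, v < n -> offs v <= q < offs v.+1 ->
     is_ends (arr s 1 q) v (arr s 2 q)) ->
  runs read_ends s (n * (offs n * 4 + 4) + 3) (fun s' =>
    forall q, q < offs n ->
      is_ends (arr s 1 q) (arr s' 6 (arr s 1 q)) (arr s' 7 (arr s 1 q))).
Proof.
move=> r0 a0 offs0 mono ends.
apply: (@runs_weaken _ _ (1 + (n * ((offs n * (2 + 2) + 2) + 2) + 2))) => //; last first.
- by move=> s' _; apply.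
- lia.
pose W q s' := forall i, i < q ->
  is_ends (arr s 1 i) (arr s' 6 (arr s 1 i)) (arr s' 7 (arr s 1 i)).
pose I v s' := reg s' 5 = offs v /\ W (offs v) s'.
apply: (@runs_seq _ _ _ _ _ (I 0)).
  by apply: runs_wp => //; split; rewrite offs0.
move=> s1 fr1 I1; apply: (runs_for (N := n) (I := I)) => //.
- by move=> s' fr; rewrite /= fr.1 // fr1.1.
- move=> v s' /= vn fr r4 [r5 Wv]; have /andP[mono1 mono2] := mono v vn.
  apply: (@runs_weaken _ _ (offs v.+1 * (2 + 2) + 2) _
    (fun s' => reg s' 5 = offs v.+1 /\ W (offs v.+1) s')) => //; last by lia.
  pose J q s' := reg s' 5 = q /\ W q s'.
  have A a i : a < 3 -> arr s' a i = arr s a i.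
    by case: a => [|[|[|a]]] // _; rewrite fr.2 // fr1.2.
  apply: (runs_for (N := offs v.+1) (I := J)) => //.
  + by move=> s2 fr2; rewrite /= fr2.2 // A // fr2.1 // r4 a0.
  + by split=> //=; rewrite r5.
  + move=> q s2; rewrite [eval _ _]/= r5 => qv fr2 r52 [_ Wq].
    have B a i : a < 3 -> arr s2 a i = arr s a i.
      by move=> a3; rewrite fr2.2 ?A //; case: a a3 => [|[|[|a]]].
    apply: runs_loop_free => //; split=> // i /=.
    rewrite r52 (fr2.1 4 isT) r4 !(B 1) // ?(B 2) // ltnS leq_eqVlt => /predU1P[->|iq].
      by rewrite eqxx; apply: ends.
    have [->|_] := eqVneq (arr s 1 i) (arr s 1 q); first exact: ends.
    exact: Wq.
  + by move=> s2 _; rewrite [eval _ _]/= r5 (maxn_idPr mono1).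
- by move=> s' _ [_]; rewrite /= max0n.
Qed.

Definition find_subtree_ends :=
  for_loop 4 (Const 1) (Reg 0)
    (Seq (SetReg 5 (Succ (Reg 4)))
    (Seq (While (Defs.Sub (Less (Reg 5) (Reg 0)) (Less (Cell 10 (Reg 5)) (Reg 4)))
            (SetReg 5 (Succ (Reg 5))))
         (SetCell 13 (Reg 4) (Reg 5)))).

(** Each scan may take [n] steps. The total of order n * n is acceptable because a connected graph
    has n <= m + 1. *)
Lemma runs_subtree_ends s n : reg s 0 = n ->
  runs find_subtree_ends s (n * (n * 2 + 5) + 2) (fun s' =>
    subtree_ends n (arr s' 13) (arr s 10)).
Proof.
move=> r0; pose ok i li :=
  [/\ i < li <= n, forall k, i < k < li -> i <= arr s 10 k
    & li < n -> arr s 10 li < i].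
pose I k s' := forall i, 0 < i < k -> ok i (arr s' 13 i).
apply: (@runs_weaken _ _ (n * ((1 + ((n * 2).+1 + 1)) + 2) + 2)) => //; last first.
- by move=> s' _; apply.
- lia.
apply: (runs_for (N := n) (I := I)) => //.
- by move=> s' fr; rewrite /= fr.1.
- by move=> i /=; lia.
- move=> i s' /= i_n fr r4 Ii.
  apply: (@runs_seq _ _ _ _ _ (fun s1 => reg s1 5 = i.+1)).
    by apply: runs_loop_free => //=; rewrite r4.
  move=> s1 fr1 r5.
  have F : forall s2, frame (SetReg 5 (Succ (Reg 5))) s1 s2 ->
      [/\ reg s2 0 = n, reg s2 4 = i & forall j, arr s2 10 j = arr s 10 j].
    move=> s2 fr2; split; first by rewrite fr2.1 // fr1.1 // fr.1.
      by rewrite fr2.1 // fr1.1.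
    by move=> j; rewrite fr2.2 // fr1.2 // fr.2.
  apply: (@runs_seq _ _ _ _ _ (fun s2 => ok i (reg s2 5))).
    pose J j s2 := [/\ j = n - reg s2 5, i < reg s2 5 <= n
      & forall k, i < k < reg s2 5 -> i <= arr s 10 k].
    apply: (@runs_weaken _ _ ((n - i.+1) * 2).+1 _ (fun s2 => ok i (reg s2 5))) => //;
      last by lia.
    apply: (runs_while (I := J)).
    + by split; rewrite r5 //; [lia|move=> k; lia].
    + move=> j s2 [jE i5 le] /F[r02 r42 a10]; rewrite /= r02 r42 a10 => lt.
      have {lt} [lt1 lt2] : reg s2 5 < n /\ i <= arr s 10 (reg s2 5).
        by move: lt; case: ltnP; case: ltnP => //=; lia.
      case: j jE => [|j] jE; first by lia.
      apply: runs_loop_free => //; split=> /=; first by lia.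
        by lia.
      move=> k /andP[ik]; rewrite ltnS leq_eqVlt => /predU1P[->|kl] //.
      by apply: le; rewrite ik.
    + move=> j s2 [jE i5 le] /F[r02 r42 a10]; rewrite /= r02 r42 a10 => e.
      split=> // lt; move: e; rewrite lt; case: ltnP => //=; lia.
  move=> s2 fr2 ok2; have [r02 r42 _] := F s2 fr2.
  apply: runs_loop_free => // j; rewrite /= r42 ltnS => ji.
  case: eqP => [->|ne] //; rewrite fr2.2 // fr1.2 //; apply: Ii; lia.
- move=> s' fr; rewrite /= => Imax i i0; apply: Imax; lia.
Qed.

Definition init_positions :=
  Seq (for_loop 4 (Const 0) (Reg 0) (SetCell 8 (Reg 4) (Reg 0)))
      (SetCell 8 (Const 0) (Const 0)).

Lemma runs_init_positions s n : reg s 0 = n ->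
  runs init_positions s (n * 3 + 3) (fun s' =>
    forall v, v < n -> arr s' 8 v = if v == 0 then 0 else n).
Proof.
move=> r0; apply: (@runs_weaken _ _ ((n * (1 + 2) + 2) + 1)) => //; last first.
- by move=> s' _; apply.
- lia.
pose I k s' := forall v, v < k -> arr s' 8 v = n.
apply: (@runs_seq _ _ _ _ _ (I n)).
  apply: (runs_for (N := n) (I := I)) => //.
  - by move=> s' fr; rewrite /= fr.1.
  - move=> k s' kn fr r4 Ik; apply: runs_loop_free => // v /=.
    rewrite r4 ltnS leq_eqVlt fr.1 //; case: eqP => [->|ne] //=.
    exact: Ik.
  - by move=> s' _; rewrite /= max0n.
move=> s1 fr1 I1; apply: runs_loop_free => // v vn /=.
by case: eqP => // _; apply: I1.
Qed.

(** Ties replace the current record, so the initial 0 in register 6 gives way even to an edge at the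
    root, whose position is 0. *)
Definition consider x y :=
  If (Less (Cell 8 (Cell x (Reg 5))) (Reg 6)) Skip
    (Seq (SetReg 6 (Cell 8 (Cell x (Reg 5))))
    (Seq (SetReg 7 (Reg 5)) (SetReg 8 (Cell y (Reg 5))))).

Definition scan_edges :=
  for_loop 5 (Const 0) (Reg 1)
    (If (Cell 3 (Reg 5))
      (If (Less (end1 (Reg 5)) (Reg 4))
        (If (Less (end2 (Reg 5)) (Reg 4)) Skip (consider 6 7))
        (If (Less (end2 (Reg 5)) (Reg 4)) (consider 7 6) Skip))
      Skip).

Definition visit :=
  Seq (SetReg 6 (Const 0)) (Seq scan_edges
    (Seq (Seq (SetCell 8 (Reg 8) (Reg 4)) (SetCell 10 (Reg 4) (Reg 6)))
         (Seq (SetCell 11 (Reg 4) (Reg 7)) (SetCell 12 (Reg 7) (Const 1))))).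

Definition search := for_loop 4 (Const 1) (Reg 0) visit.

Section Search.
Variables (n m : nat) (G : mgraph 'I_n 'I_m) (S : {set 'I_m}) (x y : 'I_m -> 'I_n).
Hypothesis ends_xy : forall e, ends G e = (x e, y e) \/ ends G e = (y e, x e).
Hypothesis connS : forall u v, connect (adjacent_in G S) u v.

Definition graph_arrays (s : state) :=
  [/\ reg s 0 = n, reg s 1 = m, forall e : 'I_m, (arr s 3 e != 0) = (e \in S),
      forall e : 'I_m, arr s 6 e = x e & forall e : 'I_m, arr s 7 e = y e].

Definition candidate (pos : 'I_n -> nat) k e u w :=
  [/\ e \in S, (u, w) = (x e, y e) \/ (u, w) = (y e, x e) & pos u < k <= pos w].

Lemma runs_scan s (pos : 'I_n -> nat) k : graph_arrays s -> reg s 4 = k ->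
  reg s 6 = 0 -> (forall v : 'I_n, arr s 8 v = pos v) ->
  (exists e u w, candidate pos k e u w) ->
  runs scan_edges s (m * 9 + 2) (fun s' => exists e u w,
    [/\ candidate pos k e u w,
        forall e' u' w', candidate pos k e' u' w' -> pos u' <= pos u
      & [/\ reg s' 6 = pos u, reg s' 7 = e & reg s' 8 = w]]).
Proof.
move=> [r0 r1 a3 a6 a7] r4 r6 a8 some.
pose best s' := exists e u w, [/\ candidate pos k e u w, reg s' 6 = pos u,
   reg s' 7 = e & reg s' 8 = w].
pose I j s' :=
  (forall e u w, candidate pos k e u w -> e < j -> pos u <= reg s' 6) /\
  ((reg s' 6 = 0 /\ forall e u w, candidate pos k e u w -> ~~ (e < j)) \/ best s').
apply: (runs_for (N := m) (b := 7) (I := I)) => //.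
- by move=> s' fr; rewrite /= fr.1.
- by split=> [e u w _|]; [rewrite ltn0|left; split=> // e u w _; rewrite ltn0].
- move=> j s' /= jm fr r5 [mx bst]; pose e := Ordinal jm.
  have a3' : arr s' 3 j = arr s 3 e by rewrite fr.2.
  have a6' : arr s' 6 j = x e by rewrite fr.2 // (a6 e).
  have a7' : arr s' 7 j = y e by rewrite fr.2 // (a7 e).
  have a8' (v : 'I_n) : arr s' 8 v = pos v by rewrite fr.2 // a8.
  have r4' : reg s' 4 = k by rewrite fr.1.
  have old (e' : 'I_m) : (e' < j.+1) = (e' == e) || (e' < j).
    by rewrite ltnS leq_eqVlt -val_eqE.
  have keep : (forall u w, candidate pos k e u w -> pos u < reg s' 6) ->
      I j.+1 (set_reg s' 5 j.+1).
    move=> none; split=> /= [e' u w c|].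
      rewrite old => /orP[/eqP E|lt]; last exact: mx c lt.
      by rewrite E in c; apply: ltnW (none _ _ c).
    case: bst => [[z none']|b]; [left|by right].
    split=> // e' u w c; rewrite old negb_or (none' e' u w) // andbT.
    by apply/eqP => E; rewrite E in c; have := none _ _ c; rewrite z.
  have new u w s1 : candidate pos k e u w -> reg s' 6 <= pos u ->
      reg s1 6 = pos u -> reg s1 7 = j -> reg s1 8 = w ->
      I j.+1 (set_reg s1 5 j.+1).
    move=> c le r61 r71 r81; split=> /= [e' u' w' c'|]; last first.
      by right; exists e, u, w.
    rewrite old r61 => /orP[/eqP E|lt]; last exact: leq_trans (mx _ _ _ c' lt) le.
    rewrite E in c'; case: c c' => _ + + [_ + +].
    by move=> [[-> ->]|[-> ->]] ? [[-> ->]|[-> ->]] ?; lia.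
  apply: runs_wp => //=; rewrite r5 a3' a3 a6' a7' !a8' r4'.
  split=> H0; last first.
    apply: keep => u w [eS _ _]; move: H0; rewrite -a3 in eS.
    by rewrite (negbTE eS).
  split; rewrite eqb0 ?negbK => H1; split; rewrite eqb0 ?negbK => H2.
  + apply: keep => u w [_ uw]; case: uw H1 H2 => [[-> ->]|[-> ->]]; lia.
  + split; rewrite eqb0 ?negbK => H3.
      apply: keep => u w [_ uw]; case: uw H1 H2 => [[-> _]|[-> ->]] //; lia.
    by apply: (new (x e) (y e)) => //=; [split=> //; [left|lia]|lia].
  + split; rewrite eqb0 ?negbK => H3.
      apply: keep => u w [_ uw]; case: uw H1 H2 => [[-> ->]|[-> _]] //; lia.
    by apply: (new (y e) (x e)) => //=; [split=> //; [right|lia]|lia].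
  + apply: keep => u w [_ uw]; case: uw H1 H2 => [[-> ->]|[-> ->]]; lia.
- move=> s' _ [mx]; rewrite /= max0n in mx *; case=> [[_ none]|].
    by case: some => e [u [w c]]; have := none _ _ _ c; rewrite ltn_ord.
  move=> [e [u [w [c r6' r7' r8']]]]; exists e, u, w; split=> // e' u' w' c'.
  by rewrite -r6'; apply: mx c' _; apply: ltn_ord.
Qed.

Definition search_arrays (s : state) k :=
  exists T pos par ch,
    [/\ search_state G S T pos par ch k, forall v : 'I_n, arr s 8 v = pos v,
        forall j, 0 < j < k -> arr s 10 j = par j,
        {in T, forall e, arr s 11 (ch e) = e}
      & forall e : 'I_m, arr s 12 e = (e \in T)].

(** Every visit rescans all edges for the latest vertex that can be extended; this replaces the
    stack of a depth-first search at a cost of O(m) per visit. *)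
Lemma runs_search s : graph_arrays s -> search_arrays s 1 ->
  runs search s (n * (m * 9 + 9) + 2) (fun s' => search_arrays s' n).
Proof.
move=> ga sa.
apply: (@runs_weaken _ _ (n * ((1 + (m * 9 + 2 + 4)) + 2) + 2)) => //; last first.
- by move=> s' _; apply.
- lia.
have n0 : 0 < n.
  have [T [pos [par [ch [st _ _ _ _]]]]] := sa.
  by have [|v _] := pos_onto st (i := 0); last apply: leq_ltn_trans (ltn_ord v).
pose I k s' := search_arrays s' k.
apply: (runs_for (N := n) (I := I)) => //.
- by move=> s' fr; rewrite /= fr.1 //; case: ga.
- move=> k s' /= kn fr r4 [T [pos [par [ch [st a8 a10 a11 a12]]]]].
  have kV : 0 < k < #|'I_n| by rewrite card_ord; lia.
  apply: (@runs_seq _ _ _ _ _ (fun s1 => reg s1 6 = 0)); first exact: runs_loop_free.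
  move=> s1 fr1 r61.
  have ga1 : graph_arrays s1.
    case: ga => g0 g1 g3 g6 g7; split; rewrite ?fr1.1 ?fr.1 // => e;
      by rewrite fr1.2 // fr.2.
  have some : exists e u w, candidate pos k e u w.
    have [e [u [w [eS uw lt]]]] := search_frontier connS st kV.
    exists e, u, w; split=> //.
    by case: uw (ends_xy e) => -> [[-> ->]|[-> ->]]; auto.
  apply: runs_seq.
    apply: (runs_scan ga1 _ r61 _ some); first by rewrite fr1.1.
    by move=> v; rewrite fr1.2.
  move=> s2 fr2 [e [u [w [[eS uw lt] mx [r62 r72 r82]]]]].
  have r42 : reg s2 4 = k by rewrite fr2.1 // fr1.1.
  apply: runs_loop_free => //; do 4 eexists; split.
  + apply: (search_step (e := e) (x := u) (y := w) st kV eS) => //.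
      by case: uw (ends_xy e) => -[-> ->] []; auto.
    move=> f fS; split=> lt'.
      apply: (mx f _ (ends G f).2); split=> //.
      by case: (ends_xy f) => ->; auto.
    apply: (mx f _ (ends G f).1); split=> //.
    by case: (ends_xy f) => ->; auto.
  + move=> v /=; rewrite r82 r42 fr2.2 // fr1.2 // a8.
    by rewrite -val_eqE.
  + move=> j jk /=; rewrite r42 r62; case: eqP => // ne.
    by rewrite fr2.2 // fr1.2 // a10 //; lia.
  + move=> f /=; rewrite in_setU1 r42 r72; case: (eqVneq f e) => [->|fe] /=.
      by rewrite eqxx.
    move=> fT; have [chf _] := tree_ends st fT.
    by rewrite ltn_eqF ?fr2.2 ?fr1.2 ?a11 //; lia.
  + move=> f /=; rewrite in_setU1 r72 fr2.2 // fr1.2 // a12 -val_eqE.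
    by case: eqP.
- by move=> s' _; rewrite /= (maxn_idPr n0).
Qed.
End Search.

(** * The layout of the adjacency list *)

Lemma offsetsS (T : Type) (ll : seq (seq T)) v : v < size ll ->
  offsets ll v.+1 = offsets ll v + size (nth [::] ll v).
Proof.
move=> vs; rewrite /offsets (take_nth 0) ?size_map // sumn_rcons.
by rewrite (nth_map [::]).
Qed.

Lemma offsets_size (T : Type) (ll : seq (seq T)) :
  offsets ll (size ll) = size (flatten ll).
Proof. by rewrite /offsets take_oversize ?size_map // size_flatten. Qed.

Lemma offsets_mono (T : Type) (ll : seq (seq T)) v w : v <= w ->
  offsets ll v <= offsets ll w.
Proof.
move=> vw; rewrite /offsets -(subnKC vw) takeD sumn_cat; exact: leq_addr.
Qed.

Lemma nth_flatten_offsets (T : Type) (x0 : T) ll v j :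
  j < size (nth [::] ll v) ->
  nth x0 (flatten ll) (offsets ll v + j) = nth x0 (nth [::] ll v) j.
Proof.
elim: ll v => [|r ll IHll] [|v] //= jlt; rewrite nth_cat.
  by rewrite /offsets take0 add0n jlt.
have -> : offsets (r :: ll) v.+1 = size r + offsets ll v by [].
by rewrite -addnA ltnNge leq_addr /= addKn IHll.
Qed.

Lemma size_count_mem (T : finType) (s : seq T) : size s = \sum_x count_mem x s.
Proof.
elim: s => [|a s IHs] /=; first by rewrite big1.
rewrite big_split /= -IHs (bigD1 a) //= eqxx big1 ?addn0 ?add1n // => x.
by rewrite eq_sym => /negbTE ->.
Qed.

Section AdjacencyList.
Variables (n m : nat) (G : mgraph 'I_n 'I_m) (L : 'I_n -> seq 'I_m).
Hypothesis adjL : ordered_adjacency_list G L.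
Local Notation rows := (adjacency_rows G L).

Lemma size_rows : size rows = n.
Proof. by rewrite size_map size_enum_ord. Qed.

Lemma nth_rows (v : 'I_n) :
  nth [::] rows v = [seq (val e, val (other_end G v e)) | e <- L v].
Proof. by rewrite (nth_map v) ?size_enum_ord // nth_ord_enum. Qed.

(** A loop is listed twice, so the lengths of the rows are the degrees and [sum_degree] applies. *)
Lemma size_flatten_rows : offsets rows n = 2 * m.
Proof.
rewrite -{2}size_rows offsets_size size_flatten /shape sumnE -map_comp big_map.
rewrite big_enum /= (eq_bigr (fun v => degree_in G [set: 'I_m] v)) => [|v _].
  by rewrite sum_degree cardsT card_ord.
rewrite /= size_map size_count_mem /degree_in big_mkcond [RHS]big_mkcond /=.
by apply: eq_bigr => e _; rewrite inE; have [->] := adjL v.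
Qed.

Lemma mem_adjacency v e : (e \in L v) = (0 < incidence G e v).
Proof. by have [<- _] := adjL v; rewrite -has_count has_pred1. Qed.

Definition is_ends q v w := forall e : 'I_m, val e = q ->
  exists x y : 'I_n, [/\ val x = v, val y = w
    & ends G e = (x, y) \/ ends G e = (y, x)].

Lemma row_entry v q : v < n -> offsets rows v <= q < offsets rows v.+1 ->
  is_ends (nth (0, 0) (flatten rows) q).1 v (nth (0, 0) (flatten rows) q).2.
Proof.
move=> vn; rewrite offsetsS ?size_rows //; set j := q - offsets rows v => qv.
have -> : q = offsets rows v + j by rewrite /j; lia.
have jlt : j < size (nth [::] rows v) by rewrite /j; lia.
rewrite nth_flatten_offsets //; move: jlt.
rewrite -[v]/(val (Ordinal vn)) nth_rows size_map; set u := Ordinal vn => jlt.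
have e0 : 'I_m by case: (L u) jlt => // e.
rewrite (nth_map e0) //= => e /val_inj ->.
have := mem_nth e0 jlt; rewrite mem_adjacency incidence_gt0 /other_end.
set f := nth _ _ _ => uf; exists u, (if (ends G f).1 == u then (ends G f).2 else (ends G f).1).
split=> //; case: eqP uf => [<- _|_ /= /eqP <-].
  by left; rewrite -surjective_pairing.
by right; rewrite -surjective_pairing.
Qed.

Lemma edge_entry (e : 'I_m) :
  exists2 q, q < offsets rows n & (nth (0, 0) (flatten rows) q).1 = e.
Proof.
pose v := (ends G e).1.
have eL : e \in L v by rewrite mem_adjacency incidence_gt0 eqxx.
have jlt : index e (L v) < size (nth [::] rows v) by rewrite nth_rows size_map index_mem.
exists (offsets rows v + index e (L v)).
  apply: leq_trans (offsets_mono rows (ltn_ord v)).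
  by rewrite offsetsS ?size_rows // ltn_add2l.
by rewrite nth_flatten_offsets // nth_rows (nth_map e) ?index_mem //= nth_index.
Qed.
End AdjacencyList.

(** The edges of a search tree carry all positions other than 0. This bound turns n * n into
    O(mn). *)
Lemma connected_card (V E : finType) (G : mgraph V E) :
  connected_graph G -> #|V| <= #|E|.+1.
Proof.
move=> [V0 conn]; have [|T [pos [par [ch st]]]] := search_exists conn (k := #|V|).
  by rewrite V0 leqnn.
have : size (iota 1 #|V|.-1) <= size [seq ch e | e <- enum T].
  apply: uniq_leq_size (iota_uniq _ _) _ => i; rewrite mem_iota => i0.
  have [|e eT <-] := ch_onto st (j := i); first by lia.
  by rewrite map_f ?mem_enum.
by rewrite size_iota size_map -cardE; have := max_card T; lia.
Qed.

Lemma subtree_ends_eq n l par par' :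
  (forall j, 0 < j < n -> par j = par' j) -> subtree_ends n l par -> subtree_ends n l par'.
Proof.
move=> eq_par sub i i0; have [lti le parl] := sub i i0.
split=> // [k kl|ln]; rewrite -eq_par; try lia; exact: le.
Qed.

(** * Correctness of the output and total running time *)

Definition core :=
  Seq read_ends (Seq init_positions (Seq search (Seq find_subtree_ends
    (Seq emit_fundamental emit_semi_fundamental)))).

Definition all_edges := for_loop 4 (Const 0) (Reg 1) (SetCell 3 (Reg 4) (Const 1)).

Section Bridge.
Variables (n m : nat) (G : mgraph 'I_n 'I_m) (S T : {set 'I_m}).
Variables (pos : 'I_n -> nat) (par : nat -> nat) (ch : 'I_m -> nat) (l : nat -> nat).
Variables (x y : 'I_m -> 'I_n) (P : nat -> nat * nat) (te : nat -> nat).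
Variables (nontree : pred nat) (X Y : nat -> nat).
Hypothesis st : search_state G S T pos par ch #|'I_n|.
Hypothesis sub : subtree_ends #|'I_n| l par.
Hypothesis ends_xy : forall e, ends G e = (x e, y e) \/ ends G e = (y e, x e).
Hypothesis PE : forall e : 'I_m, P e = (pos (x e), pos (y e)).
Hypothesis teE : {in T, forall e, te (ch e) = e}.
Hypothesis nontreeE : forall e : 'I_m, nontree e = (e \notin T).
Hypothesis nontree_lt : forall e, nontree e -> e < m.
Local Notation chosen := (chosen m P l nontree).
Hypothesis XY : {in iota 1 n.-1, forall t, chosen t ->
  tight_pair n l P nontree t (X t) (Y t)}.
Local Notation endp := (end_positions G pos).
Local Notation covers := (in_cover l endp (fun e => e \notin T)).

Let crE i (e : 'I_m) : crossing l i (P e) = crossing l i (endp e).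
Proof.
by rewrite PE /end_positions; case: (ends_xy e) => ->; rewrite // /crossing addbC.
Qed.

Let coversE i (e : 'I_m) : in_cover l P nontree i e = covers i e.
Proof. by rewrite /in_cover nontreeE crE. Qed.

Let ord_of e : nontree e -> exists e' : 'I_m, e = e'.
Proof. by move=> /nontree_lt lt; exists (Ordinal lt). Qed.

Let covering_listE i :
  covering_list m P l nontree i = [seq val e | e <- enum 'I_m & covers i e].
Proof.
rewrite /covering_list -val_enum_ord filter_map; congr map.
by apply: eq_filter => e /=; rewrite coversE.
Qed.

Let size_covering i : size (covering_list m P l nontree i) = #|[set e | covers i e]|.
Proof.
rewrite covering_listE size_map size_filter -sum1_count -sum1_card big_enum_cond.
by apply: eq_bigl => e; rewrite inE.
Qed.

Let tree_edge i : 0 < i < n -> exists2 e, e \in T & ch e = i.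
Proof. by move=> i0; apply: (ch_onto st); rewrite card_ord. Qed.

Let tree_index e : e \in T -> 0 < ch e < n.
Proof. by move/(tree_ends st) => []; rewrite card_ord. Qed.

Let R := [set t in T | chosen (ch t)].
Let xR (t : 'I_m) : 'I_m := insubd t (X (ch t)).
Let yR (t : 'I_m) : 'I_m := insubd t (Y (ch t)).

Let in_iota i : (i \in iota 1 n.-1) = (0 < i < n).
Proof. by rewrite mem_iota; lia. Qed.

Let R_tree : {subset R <= T}.
Proof. by move=> t; rewrite inE => /andP[]. Qed.

Let xyR_val t : t \in R -> [/\ X (ch t) = xR t, Y (ch t) = yR t
  & tight_pair n l P nontree (ch t) (X (ch t)) (Y (ch t))].
Proof.
rewrite inE => /andP[tT cht]; have := XY _ cht.
rewrite in_iota tree_index // => /(_ isT) tight; have [cX cY _ _] := tight.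
have /andP[/nontree_lt Xm _] := cX; have /andP[/nontree_lt Ym _] := cY.
by split; rewrite // /xR /yR val_insubd ?Xm ?Ym.
Qed.

Let xyR : {in R, forall t, tight_pair #|'I_n| l endp (fun e => e \notin T)
  (ch t) (xR t) (yR t)}.
Proof.
move=> t /xyR_val[-> -> [cx cy ne tight]]; split; rewrite -?coversE // card_ord.
move=> s s0; rewrite -!crE => sx sy e; rewrite -coversE -crE; exact: tight.
Qed.

Let repeatedP t : 0 < t < n ->
  reflect (exists2 s, 0 < s < t & covers s =1 covers t) (repeated m P l nontree t).
Proof.
move=> t0; apply: (iffP hasP) => -[s si st']; exists s.
- by move: si; rewrite mem_iota; lia.
- move=> e; rewrite -!coversE -!(mem_covering_list (m := m)) //.
  by rewrite (eqP st').
- by rewrite mem_iota; lia.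
apply/eqP; rewrite !covering_listE; congr map; exact: eq_filter.
Qed.

(** Only repetitions of an earlier edge are discarded, so the first edge of each class survives; the
    induction walks back to it. *)
Let R_rep : {in T, forall t, 1 < #|[set e | covers (ch t) e]| ->
  exists2 i, i \in R & covers (ch i) =1 covers (ch t)}.
Proof.
move=> t; move: {2}(ch t).+1 (ltnSn (ch t)) => k.
elim: k t => // k IHk t; rewrite ltnS => tk tT N2; have t0 := tree_index tT.
have [rep|nrep] := boolP (repeated m P l nontree (ch t)); last first.
  by exists t; rewrite // inE tT /chosen size_covering N2.
have [s s0 st'] := repeatedP t0 rep; have [|u uT us] := tree_edge (i := s); first by lia.
have [| |i iR iu] := IHk u _ uT; first by lia.
  rewrite (_ : [set e | covers (ch u) e] = [set e | covers (ch t) e]) //.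
  by apply/setP => e; rewrite !inE us st'.
by exists i => // e; rewrite iu us st'.
Qed.

Let R_inj : {in R &, forall t s, covers (ch t) =1 covers (ch s) -> t = s}.
Proof.
have H t s : t \in R -> s \in R -> covers (ch t) =1 covers (ch s) -> ch s <= ch t.
  rewrite !inE => /andP[tT _] /andP[sT /andP[_ nrep]] ts; rewrite leqNgt.
  apply: contra nrep => lt; apply/repeatedP; first exact: tree_index.
  by exists (ch t) => //; have := tree_index tT; lia.
move=> t s tR sR ts; apply: (ch_inj st); rewrite ?R_tree //.
by apply/eqP; rewrite eqn_leq !H // => e; rewrite ts.
Qed.

Let as_set (c : seq nat) := [set e : 'I_m | val e \in c].

Let mem_tree_edges (C : pred nat) (f : 'I_m) :
  (val f \in [seq te i | i <- iota 1 n.-1 & C i]) = (f \in T) && C (ch f).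
Proof.
apply/mapP/andP => [[i]|[fT Cf]].
  rewrite mem_filter in_iota => /andP[Ci /tree_edge[e eT ei]].
  by rewrite -ei teE // => /val_inj ->; rewrite ei.
by exists (ch f); rewrite ?teE // mem_filter Cf in_iota tree_index.
Qed.

Let uniq_tree_edges (C : pred nat) : uniq [seq te i | i <- iota 1 n.-1 & C i].
Proof.
rewrite map_inj_in_uniq ?filter_uniq ?iota_uniq // => i j.
rewrite !mem_filter !in_iota => /andP[_ /tree_edge[e eT <-]] /andP[_ /tree_edge[f fT <-]].
by rewrite !teE // => /val_inj ->.
Qed.

Let as_set_fundamental (e : 'I_m) : e \notin T ->
  as_set (fundamental_list n P l te e) = ci G T e.
Proof.
move=> eT; have [_ /subsetP sC eC] := ciP (search_tree st sub) eT.
apply/setP => f; rewrite !inE mem_tree_edges crE val_eqE.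
have [fT|fT] /= := boolP (f \in T).
  have -> : (f == e) = false by apply: contraNF eT => /eqP <-.
  by rewrite (in_ci_crossing st sub).
by rewrite orbF (ci_nontree (search_tree st sub)).
Qed.

Let as_set_pair (e f : 'I_m) : e \notin T -> f \notin T -> e != f ->
  as_set (pair_list n P l te e f) = ci2 G T e f.
Proof.
move=> eT fT ef; have tr := search_tree st sub.
apply/setP => g; rewrite in_ci2 !inE mem_tree_edges !crE !val_eqE.
have [gT|gT] /= := boolP (g \in T).
  have -> : (g == e) = false by apply: contraNF eT => /eqP <-.
  have -> : (g == f) = false by apply: contraNF fT => /eqP <-.
  by rewrite !(in_ci_crossing st sub).
rewrite orbF !(ci_nontree tr) //; case: (eqVneq g e) => [->|_] //=.
Qed.

Definition cycle_lists :=
  [seq fundamental_list n P l te e | e <- iota 0 m & nontree e] ++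
  [seq pair_list n P l te (X t) (Y t) | t <- iota 1 n.-1 & chosen t].

Let cycle_listsP c : c \in cycle_lists ->
  (exists2 e, e \notin T & c = fundamental_list n P l te (val e)) \/
  (exists2 t, t \in R & c = pair_list n P l te (xR t) (yR t)).
Proof.
rewrite mem_cat => /orP[] /mapP[i]; rewrite mem_filter.
  case/andP=> ni _ ->; have [e ie] := ord_of ni.
  by left; exists e; [rewrite -nontreeE -ie|rewrite ie].
rewrite in_iota => /andP[chi i0] ->; have [t tT ti] := tree_edge i0.
have tR : t \in R by rewrite inE tT ti.
by right; exists t => //; have [<- <- _] := xyR_val tR; rewrite ti.
Qed.

Let pairP t : t \in R -> [/\ xR t \notin T, yR t \notin T & xR t != yR t].
Proof. by move/xyR=> [/andP[? _] /andP[? _] ? _]. Qed.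

Let cycle_list_ok c : c \in cycle_lists -> uniq c && all (fun e => e < m) c.
Proof.
have tl C : all (fun e => e < m) [seq te i | i <- iota 1 n.-1 & C i].
  apply/allP => k /mapP[i]; rewrite mem_filter in_iota => /andP[_ /tree_edge[e eT <-]].
  by rewrite teE // => ->.
case/cycle_listsP=> [[e eT ->]|[t /pairP[xT yT xy] ->]] /=.
  by rewrite uniq_tree_edges tl ltn_ord mem_tree_edges (negbTE eT).
rewrite uniq_tree_edges tl !ltn_ord inE !mem_tree_edges (negbTE xT) (negbTE yT).
by rewrite val_eqE (negbTE xy).
Qed.

Let B := pair_basis G T R xR yR.

Let basis_lists : B = [set C in [seq as_set c | c <- cycle_lists]].
Proof.
apply/setP => C; rewrite [RHS]inE; apply/idP/mapP => [/setUP[]|[c cl ->]].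
- move=> /imsetP[e]; rewrite inE => eT ->.
  exists (fundamental_list n P l te e); last by rewrite as_set_fundamental.
  by rewrite mem_cat map_f // mem_filter nontreeE eT mem_iota ltn_ord.
- move=> /imsetP[t tR ->]; have [xT yT xy] := pairP tR.
  exists (pair_list n P l te (xR t) (yR t)); last by rewrite as_set_pair.
  have [<- <- _] := xyR_val tR; rewrite mem_cat orbC.
  move: tR; rewrite inE => /andP[tT cht].
  by rewrite (map_f (fun i => pair_list n P l te (X i) (Y i))) // mem_filter cht in_iota tree_index.
apply/setUP; case/cycle_listsP: cl => [[e eT ->]|[t tR ->]].
  by left; rewrite as_set_fundamental // imset_f // inE.
have [xT yT xy] := pairP tR; right; rewrite as_set_pair //.
by apply/imsetP; exists t.
Qed.

Let uniq_cycle_lists : uniq [seq as_set c | c <- cycle_lists].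
Proof.
have tr := search_tree st sub.
rewrite map_cat cat_uniq; apply/and3P; split.
- rewrite -map_comp map_inj_in_uniq ?filter_uniq ?iota_uniq // => i j.
  rewrite !mem_filter => /andP[/[dup] ni /ord_of[e ie] _] /andP[/[dup] nj /ord_of[f jf] _].
  move: ni nj; rewrite ie jf !nontreeE => eT fT /=.
  rewrite !as_set_fundamental // => /(ci_inj tr) ->; rewrite ?inE //.
- apply/hasPn => C /mapP[c cl ->]; apply/mapP => -[d dl].
  move: cl dl => /mapP[i + ->] /mapP[j + ->]; rewrite !mem_filter in_iota.
  move=> /andP[chi /tree_edge[t tT ti]] /andP[/[dup] nj /ord_of[e je] _].
  have tR : t \in R by rewrite inE tT ti.
  have [xT yT xy] := pairP tR; have [Xt Yt _] := xyR_val tR.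
  rewrite -ti Xt Yt je as_set_pair // as_set_fundamental -?nontreeE -?je // => /esym/eqP.
  apply/negP; apply: (search_ci_neq st sub R_tree xyR) => //.
  by rewrite -nontreeE -je.
- rewrite -map_comp map_inj_in_uniq ?filter_uniq ?iota_uniq // => i j.
  rewrite !mem_filter !in_iota => /andP[chi /tree_edge[t tT ti]].
  move=> /andP[chj /tree_edge[u uT uj]].
  have tR : t \in R by rewrite inE tT ti.
  have uR : u \in R by rewrite inE uT uj.
  have [xT yT xy] := pairP tR; have [Xt Yt _] := xyR_val tR.
  have [xT' yT' xy'] := pairP uR; have [Xu Yu _] := xyR_val uR.
  rewrite /= -ti -uj Xt Yt Xu Yu !as_set_pair // => eq2.
  by rewrite (search_pair_inj st sub R_tree xyR R_inj tR uR eq2).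
Qed.

Lemma bridge : semi_fundamental_basis G T B /\
  forall s, outputs s cycle_lists [::] -> output_is s B.
Proof.
split=> [|s [o2 o4 o3 o5]]; first exact: (search_basis st sub R_tree xyR R_rep R_inj).
(* The machine stores natural numbers; as all of them are below [m], they lift to the lists of
   ordinals that [output_is] asks for. *)
have [ll llE] : exists ll : seq (seq 'I_m), map (map val) ll = cycle_lists.
  have : all (all (fun e => e < m)) cycle_lists.
    by apply/allP => c /cycle_list_ok/andP[].
  elim: cycle_lists => [|c cs IHcs] /=; first by exists [::].
  case/andP=> cm /IHcs[ll <-]; suff [d <-] : exists d : seq 'I_m, map val d = c.
    by exists (d :: ll).
  elim: c cm => [|k c IHc] /=; first by exists [::].
  by case/andP=> km /IHc[d <-]; exists (Ordinal km :: d).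
have sets : [seq [set e in c] | c <- ll] = [seq as_set c | c <- cycle_lists].
  rewrite -llE -map_comp; apply: eq_map => c; apply/setP => e /=.
  by rewrite !inE mem_map //; apply: val_inj.
have flat : map val (flatten ll) = flatten cycle_lists by rewrite map_flatten llE.
have offsE i : offsets ll i = offsets cycle_lists i.
  rewrite /offsets -llE -map_comp; congr (sumn (take _ _)).
  by apply: eq_map => c /=; rewrite size_map.
exists ll; split.
- apply/allP => c cl; have : map val c \in cycle_lists by rewrite -llE map_f.
  by case/cycle_list_ok/andP; rewrite map_inj_uniq //; apply: val_inj.
- by rewrite sets uniq_cycle_lists.
- by rewrite sets basis_lists.
- by rewrite o2 -llE size_map.
split=> i ilt.
  by rewrite offsE o4 // -llE size_map.
by rewrite flat o5 cats0 // -flat size_map.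
Qed.
End Bridge.

Section Core.
Variables (n m : nat) (G : mgraph 'I_n 'I_m) (L : 'I_n -> seq 'I_m).
Hypotheses (connG : connected_graph G) (adjL : ordered_adjacency_list G L).

(* The edges to be searched are marked in array 3. *)
Definition core_input (S : {set 'I_m}) (s : state) :=
  [/\ forall r, r < 4 -> reg s r = reg (graph_input G L) r,
      forall a i, a != 3 -> arr s a i = arr (graph_input G L) a i
    & forall e : 'I_m, (arr s 3 e != 0) = (e \in S)].

Lemma card_vertices : 0 < n <= m.+1.
Proof.
by have := connected_card connG; have := connG.1; rewrite !card_ord => -> ->.
Qed.

Lemma runs_core S s : core_input S s ->
  (forall u v, connect (adjacent_in G S) u v) ->
  runs core s (190 * (m * n).+1) (fun s' => exists (T : {set 'I_m}) B,
    [/\ T \subset S, spanning_tree G T, semi_fundamental_basis G T B & output_is s' B]).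
Proof.
move=> [sr sa s3] connS; have /andP[n0 nm] := card_vertices.
(* These bounds reduce every term to m * n and a constant: the six phases add up to at most 174 * (m
   * n) + 105. *)
have [n1 m1 n2] : [/\ n <= m * n + 1, m <= m * n & n * n <= m * n + n].
  by split; nia.
pose b1 := n * (2 * m * 4 + 4) + 3; pose b2 := n * 3 + 3.
pose b3 := n * (m * 9 + 9) + 2; pose b4 := n * (n * 2 + 5) + 2.
pose b5 := m * (n * 5 + 9) + 2; pose b6 := n * (m * 24 + n * 26 + 42) + 2.
apply: (@runs_weaken _ _ (b1 + (b2 + (b3 + (b4 + (b5 + b6)))))) => //; last first.
- by move=> s' _; apply.
- by rewrite /b1 /b2 /b3 /b4 /b5 /b6; nia.
have r0 : reg s 0 = n by rewrite sr.
have r1 : reg s 1 = m by rewrite sr.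
set flat := flatten (adjacency_rows G L).
have a1 i : arr s 1 i = (nth (0, 0) flat i).1 by rewrite sa.
have a2 i : arr s 2 i = (nth (0, 0) flat i).2 by rewrite sa.
apply: (@runs_seq _ _ _ _ _ (fun s1 => forall e : 'I_m,
    exists xy : 'I_n * 'I_n, [/\ arr s1 6 e = xy.1, arr s1 7 e = xy.2
      & ends G e = xy \/ ends G e = (xy.2, xy.1)])).
  rewrite /b1 -(size_flatten_rows adjL).
  have H := @runs_read_ends s n (offsets (adjacency_rows G L)) (is_ends G) r0.
  apply: (runs_weaken (H _ _ _ _)) => //.
  - by move=> i il; rewrite sa //= il.
  - by rewrite /offsets take0.
  - move=> v vn; rewrite !offsets_mono //.
  - by move=> v q vn qv; rewrite a1 a2; apply: (row_entry adjL).
  move=> s1 _ ok e; have [q qn qe] := edge_entry adjL e.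
  have := ok q qn e; rewrite a1 qe => /(_ erefl)[x [y [xE yE exy]]].
  by exists (x, y).
move=> s1 fr1 /fin_all_exists[xy xyP]; apply: runs_seq.
  by apply: runs_init_positions; rewrite fr1.1.
move=> s2 fr2 pos2; pose x e := (xy e).1; pose y e := (xy e).2.
have ends_xy e : ends G e = (x e, y e) \/ ends G e = (y e, x e).
  by have [_ _] := xyP e; rewrite /x /y -surjective_pairing.
have ga : graph_arrays S x y s2.
  split=> [||e|e|e]; rewrite ?fr2.1 ?fr1.1 //.
  - by rewrite fr2.2 // fr1.2.
  - by rewrite fr2.2 //; have [] := xyP e.
  - by rewrite fr2.2 //; have [] := xyP e.
apply: (@runs_seq _ _ _ _ _ (fun s3 => search_arrays G S s3 n)).
  apply: (runs_search ends_xy connS ga).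
  exists set0, (fun v => if v == Ordinal n0 then 0 else #|'I_n|), (fun=> 0), (fun=> 0).
  split; first exact: search_start.
  - by move=> v; rewrite pos2 // card_ord -val_eqE.
  - by move=> j; lia.
  - by move=> e; rewrite inE.
  - by move=> e; rewrite inE fr2.2 // fr1.2 // sa.
move=> s3' fr3 [T [pos [par [ch [st a8 a10 a11 a12]]]]].
have st' : search_state G S T pos par ch #|'I_n| by rewrite card_ord.
apply: runs_seq.
  by apply: runs_subtree_ends; rewrite fr3.1 // fr2.1 // fr1.1.
move=> s4 fr4 sub4.
have sub : subtree_ends #|'I_n| (arr s4 13) par.
  by rewrite card_ord; apply: subtree_ends_eq sub4 => j j0; apply: a10.
pose P e := (arr s4 8 (arr s4 6 e), arr s4 8 (arr s4 7 e)).
(* The bound [e < m] is built in because array 12 is described only on edges. *)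
pose nontree e := (e < m) && (arr s4 12 e == 0).
have env : environment n m P (arr s4 13) (arr s4 11) nontree s4.
  split=> [||e em|i i0] //; first by rewrite fr4.1 // fr3.1 // fr2.1 // fr1.1.
    by rewrite fr4.1 // fr3.1 // fr2.1 // fr1.1.
  by rewrite /nontree em.
have out4 : outputs s4 [::] [::].
  split=> //; first by rewrite fr4.1 // fr3.1 // fr2.1 // fr1.1 // sr.
  - case=> // _; rewrite fr4.2 // fr3.2 // fr2.2 // fr1.2 // sa //.
  - by rewrite fr4.1 // fr3.1 // fr2.1 // fr1.1 // sr.
have PE (e : 'I_m) : P e = (pos (x e), pos (y e)).
  have [e6 e7 _] := xyP e.
  rewrite /P ![arr s4 _ _]fr4.2 // ![arr s3' 6 _]fr3.2 // ![arr s3' 7 _]fr3.2 //.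
  by rewrite ![arr s2 _ _]fr2.2 // e6 e7 !a8.
have teE : {in T, forall e, arr s4 11 (ch e) = e}.
  by move=> e eT; rewrite fr4.2 // a11.
have nontreeE (e : 'I_m) : nontree e = (e \notin T).
  by rewrite /nontree ltn_ord fr4.2 // a12 eqb0.
have nontree_lt e : nontree e -> e < m by case/andP.
have P_lt e : nontree e -> (P e).1 < n /\ (P e).2 < n.
  have lt v : pos v < n by have := search_pos_lt st' v; rewrite card_ord.
  by move=> /nontree_lt em; rewrite (PE (Ordinal em)); split; apply: lt.
have lam : laminar n (arr s4 13) by apply: subtrees_laminar sub4.
apply: (runs_seq (runs_fundamental env out4)).
move=> s5 fr5 out5; have env5 := environment_frame fr5 isT isT env.
have := runs_semi_fundamental nontree_lt P_lt lam env5 out5.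
move/runs_weaken; apply=> // s6 fr6 [X [Y [XY out6]]].
have [bas out] := bridge st' sub ends_xy PE teE nontreeE nontree_lt XY.
by do 2 eexists; split; [exact: tree_sub st'|exact: search_tree st' sub|exact: bas|exact: out].
Qed.
End Core.

Theorem theorem1p3 :
  (* existence *)
  (forall (V E : finType) (G : mgraph V E), connected_graph G ->
     (exists B : {set {set E}}, lattice_cycle_basis G B) /\
     (forall T : {set E}, spanning_tree G T ->
        exists B : {set {set E}}, semi_fundamental_basis G T B)) /\
  (* construction in time O(mn) *)
  (exists (p : program) (c : nat),
     forall (n m : nat) (G : mgraph 'I_n 'I_m) (L : 'I_n -> seq 'I_m),
       connected_graph G -> ordered_adjacency_list G L ->
       exists B : {set {set 'I_m}},
         outputs_within p (graph_input G L) (c * (m * n).+1) B /\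
         lattice_cycle_basis G B) /\
  (* construction in time O(mn), for a prescribed spanning tree *)
  (exists (p : program) (c : nat),
     forall (n m : nat) (G : mgraph 'I_n 'I_m) (L : 'I_n -> seq 'I_m)
            (T : {set 'I_m}),
       connected_graph G -> ordered_adjacency_list G L -> spanning_tree G T ->
       exists B : {set {set 'I_m}},
         outputs_within p (graph_tree_input G L T) (c * (m * n).+1) B /\
         semi_fundamental_basis G T B).
Proof.
split; last split.
- move=> V E G [V0 connG]; split=> [|T]; last exact: semi_fundamental_basis_exists.
  by have [T [B [_ _ [bas _ _]]]] := basis_exists V0 connG; exists B.
(* Marking all edges takes 3 * m + 2 steps, at most 10 * (m * n + 1). The successor in the bound
   covers the single vertex without edges, where m * n = 0. *)
- exists (Seq all_edges core), 200 => n m G L connG adjL.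
  have /andP[n0 nm] := card_vertices connG.
  suff : runs (Seq all_edges core) (graph_input G L) ((m * 3 + 2) + 190 * (m * n).+1)
      (fun s' => exists (T : {set 'I_m}) B, [/\ T \subset setT, spanning_tree G T,
         semi_fundamental_basis G T B & output_is s' B]).
    move=> [t [s' [ex tb [T [B [_ _ [bas _ _] out]]]]]]; exists B; split=> //.
    by exists t, s'; split=> //; apply: leq_trans tb _; nia.
  apply: (@runs_seq _ _ _ _ _ (fun s => forall e, e < m -> arr s 3 e = 1)).
    pose I k s := forall e, e < k -> arr s 3 e = 1.
    apply: (runs_for (N := m) (b := 1) (I := I)) => //.
    + by move=> s fr; rewrite /= fr.1.
    + move=> k s km fr r4 Ik; apply: runs_loop_free => // e /=.
      rewrite r4 ltnS leq_eqVlt; case: eqP => //= _; exact: Ik.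
    + by move=> s _; rewrite /= max0n.
  move=> s fr a3; apply: (runs_core connG adjL (S := setT)); last exact: connG.2.
  split=> [r|a i a_3|e].
  + by move=> r4; apply: fr.1; rewrite !inE ltn_eqF.
  + by apply: fr.2; rewrite inE.
  + by rewrite a3 // inE.
(* Array 3 of the input already marks [T], so the search runs inside [T] and can only return [T]
   itself. *)
- exists core, 190 => n m G L T connG adjL treeT.
  have [|t [s' [ex tb [T' [B [sT tr bas out]]]]]] :=
      @runs_core n m G L connG adjL T (graph_tree_input G L T) _ treeT.1.
    split=> // [a i /negbTE a3|e]; first by rewrite /= a3.
    by rewrite /= eqb0 negbK mem_map ?mem_enum //; apply: val_inj.
  have TT := spanning_tree_sub treeT tr sT; rewrite TT in bas.
  by exists B; split=> //; exists t, s'.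
Qed.
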